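(* Let $C(B,N)$ be the free associative conformal algebra over a field $\mathbf{k}$ of characteristic $0$ generated by a well-ordered set $B$ with a bounded locality $N$. For any ideal $I$ of $C(B,N)$, $I$ has a unique reduced Gröbner-Shirshov basis, i.e. there is exactly one set $S\subset C(B,N)$ of monic elements that is a reduced Gröbner-Shirshov basis in $C(B,N)$ and satisfies $Id(S)=I$.
   Context: Conformal algebras. $\mathbf{k}$ is a field of characteristic $0$. A conformal algebra is a $\mathbf{k}$-space $C$ with bilinear products $a_{(n)}b$ ($n\in\mathbb{Z}_{\ge0}$) and a linear map $D$ such that: for all $a,b$ there is $N(a,b)\in\mathbb{Z}_{\ge 0}$ with $a_{(n)}b=0$ for $n\ge N(a,b)$; $D(a_{(n)}b)=Da_{(n)}b+a_{(n)}Db$; $Da_{(n)}b=-n\,a_{(n-1)}b$ for $n>0$ and $Da_{(0)}b=0$. It is associative if $(a_{(n)}b)_{(m)}c=\sum_{t\ge0}(-1)^t\binom nt a_{(n-t)}(b_{(m+t)}c)$. An ideal is a $D$-stable subspace closed under all products with arbitrary elements on either side; $Id(S)$ is the ideal generated by $S$. For $N\in\mathbb{Z}_{\ge0}$, $C(B,N)$ is the free associative conformal algebra generated by $B$ subject to $a_{(n)}b=0$ for $a,b\in B$, $n\ge N$: any map $\varepsilon$ from $B$ to an associative conformal algebra $C$ with $\varepsilon(a)_{(n)}\varepsilon(b)=0$ for all $a,b\in B$, $n\ge N$ extends uniquely to a homomorphism $C(B,N)\to C$. Words. $T$ is the set of associative normal words $u=b_{1(n_1)}b_{2(n_2)}\cdots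 b_{k(n_k)}D^ib_{k+1}$ with $b_j\in B$, $0\le n_j<N$, $k,i\ge0$; $|u|=k+1$, $ind(u)=i$; $u$ is $D$-free if $ind(u)=0$. $[u]=b_{1(n_1)}(b_{2(n_2)}(\cdots(b_{k(n_k)}D^ib_{k+1})\cdots))\in C(B,N)$ is the corresponding (right-normed) normal word; square brackets always denote right-normed bracketing. It is known that $\{[u]:u\in T\}$ is a $\mathbf{k}$-basis of $C(B,N)$. An element of $C(B,N)$ is $D$-free if all normal words occurring in it are. $uD^l$ is $u$ with $D^ib_{k+1}$ replaced by $D^{i+l}b_{k+1}$. If $u$ is $D$-free and $0\le n<N$, $u_{(n)}v\in T$ is the concatenation; if $a$ is empty, $a_{(n)}v$ means $v$. Ordering. $B$ is well-ordered; for $u\in T$, $wt(u)=(|u|,b_1,n_1,\dots,b_k,n_k,b_{k+1},i)$, and $u>v$ iff $wt(u)>wt(v)$ lexicographically; this well-orders $T$, and $u>0$ for all $u\in T$. For $0\ne f\in C(B,N)$, $\bar f\in T$ is the largest word occurring in $f$; $\bar0=0$; $f$ is monic if $\bar f$ has coefficient $1$. Normal $S$-words. For a set $S$ of monic elements, a normal $S$-word $[u]_{D^is}$ is either (first kind) $[a_{(n)}s_{(m)}c]$ with $s\in S$, $a,c\in T$ ($a$ may be empty), $a$ and $\bar s$ $D$-free, $0\le n,m<N$; or (second kind) $[a_{(n)}D^is]$ with $s\in S$, $i\ge0$, $a\in T$ $D$-free ($a$ may be empty), $0\le n<N$. Here, for $a=b_{1(n_1)}\cdots b_{k(n_k)}b_{k+1}$,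 $[a_{(n)}s_{(m)}c]=b_{1(n_1)}(\cdots(b_{k+1(n)}(s_{(m)}[c]))\cdots)$ and $[a_{(n)}D^is]=b_{1(n_1)}(\cdots(b_{k+1(n)}D^is)\cdots)$. $Irr(S)$ is the set of normal words $[u]$, $u\in T$, such that $u\ne\overline{[v]_{D^is}}$ for every normal $S$-word $[v]_{D^is}$. Compositions of monic $f,g$ (all product indices occurring in words lie in $[0,N)$): - inclusion: if $w=\bar f=a_{(n)}\bar g_{(m)}c$, $a,c\in T$, $a,\bar g$ $D$-free ($a$ may be empty), $(f,g)_w=f-[a_{(n)}g_{(m)}c]$; - right inclusion: if $w=\bar f=a_{(n)}\bar gD^i$, $a\in T$ $D$-free ($a$ may be empty), $i\ge0$, $(f,g)_w=f-[a_{(n)}D^ig]$; - intersection: if $w=\bar f_{(m)}c=a_{(n)}\bar g$, $a,c\in T$, $a,\bar f$ $D$-free, $|\bar f|+|\bar g|>|w|$, $(f,g)_w=[f_{(m)}c]-[a_{(n)}g]$; - right intersection: if $w=\bar fD^i=a_{(n)}\bar g$, $a\in T$ $D$-free, $i>0$, $(f,g)_w=D^if-[a_{(n)}g]$; - left multiplication: $b_{(n)}f$ with $b\in B$, $n\ge N$; - right multiplication: $f_{(n)}b$ with $b\in B$ and either ($\bar f$ not $D$-free and $0\le n<N$) or ($f$ not $D$-free and $n\ge N$). An element $h$ is trivial modulo $S$ if $h$ is a finite $\mathbf{k}$-linear combination of normal $S$-words $[u_i]_{D^{l_i}s_i}$ with $\overline{[u_i]_{D^{l_i}s_i}}\le\bar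 h$. $S$ is a Gröbner-Shirshov basis in $C(B,N)$ if all compositions of elements of $S$ are trivial modulo $S$. For $s=\sum_{i=1}^n\alpha_i[u_i]$ with $0\ne\alpha_i\in\mathbf{k}$ and distinct $u_i\in T$, put $supp(s)=\{u_1,\dots,u_n\}$. A Gröbner-Shirshov basis $S$ is reduced if for every $s\in S$ each $u\in supp(s)$ satisfies $[u]\in Irr(S\setminus\{s\})$. *)

(* Defs.v *)
From HB Require Import structures.
From mathcomp Require Import all_boot all_order all_algebra.
From mathcomp Require Import boolp classical_sets.

Set Implicit Arguments.
Unset Strict Implicit.
Unset Printing Implicit Defensive.

Import Order.TTheory GRing.Theory.
Local Open Scope classical_set_scope.
Local Open Scope ring_scope.

HB.mixin Record isConformal (k : fieldType) C of GRing.Lmodule k C := {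
  cderiv : C -> C;
  cprod : nat -> C -> C -> C;
  cderiv_linear : linear cderiv;
  cprod_linear_l : forall n b, linear (fun a => cprod n a b);
  cprod_linear_r : forall n a, linear (fun b => cprod n a b);
  cprod_locality :
    forall a b, exists M : nat, forall n, (M <= n)%N -> cprod n a b = 0;
  cderiv_prod : forall n a b,
    cderiv (cprod n a b) = cprod n (cderiv a) b + cprod n a (cderiv b);
  cprodS_deriv_l : forall n a b,
    cprod n.+1 (cderiv a) b = - (n.+1%:R *: cprod n a b);
  cprod0_deriv_l : forall a b, cprod 0 (cderiv a) b = 0 }.

#[short(type="conformalType")]
HB.structure Definition Conformal (k : fieldType) :=
  {C of isConformal k C & GRing.Lmodule k C}.

(* The sum over t stops at t = n because 'C(n, t) vanishes beyond. *)
HB.mixin Record Conformal_isAssoc (k : fieldType) C of Conformal k C := {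
  cprodA : forall n m (a b c : C),
    cprod m (cprod n a b) c =
    \sum_(t < n.+1) ((-1) ^+ t * 'C(n, t)%:R) *:
       cprod (n - t) a (cprod (m + t) b c) }.

#[short(type="assocConformalType")]
HB.structure Definition AssocConformal (k : fieldType) :=
  {C of Conformal_isAssoc k C & Conformal k C}.

Notation "a '*_(' n ')' b" := (cprod n a b)
  (at level 40, n at level 200, left associativity, format "a  '*_(' n ')'  b").

Definition conformal_hom (k : fieldType) (C C' : conformalType k)
    (phi : C -> C') : Prop :=
  [/\ linear phi, forall a, phi (cderiv a) = cderiv (phi a)
    & forall n a b, phi (a *_(n) b) = phi a *_(n) phi b].

Definition has_locality (k : fieldType) (B : Type) (N : nat)
    (C : conformalType k) (eps : B -> C) : Prop :=
  forall a b n, (N <= n)%N -> eps a *_(n) eps b = 0.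

(* [C], with the map [eta : B -> C], is C(B,N). *)
Definition is_free_assoc_conformal (k : fieldType) (B : Type) (N : nat)
    (C : assocConformalType k) (eta : B -> C) : Prop :=
  has_locality N eta /\
  forall (A : assocConformalType k) (eps : B -> A), has_locality N eps ->
    exists! phi : C -> A,
      conformal_hom phi /\ (forall b, phi (eta b) = eps b).

Definition is_ideal (k : fieldType) (C : conformalType k) (I : set C) : Prop :=
  [/\ I 0,
      forall (x : k) a b, I a -> I b -> I (x *: a + b),
      forall a, I a -> I (cderiv a)
    & forall n a b, I a -> I (a *_(n) b) /\ I (b *_(n) a)].

Definition ideal_gen (k : fieldType) (C : conformalType k) (S : set C) :
    set C :=
  smallest (@is_ideal k C) S.

(* ((p, b), i) is the word b_1(n_1) ... b_k(n_k) D^i b with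
   p = [:: (b_1, n_1); ...; (b_k, n_k)]. *)
Definition word (d : Order.disp_t) (B : orderType d) (N : nat) : Type :=
  (seq (B * 'I_N) * B * nat)%type.

Section Words.
Context {d : Order.disp_t} {B : orderType d} {N : nat}.
Implicit Types (u v : word B N) (p : seq (B * 'I_N)).

Definition wprefix u : seq (B * 'I_N) := u.1.1.
Definition wlast u : B := u.1.2.
Definition wind u : nat := u.2.
Definition wlen u : nat := (size (wprefix u)).+1.
Definition wDfree u : Prop := wind u = 0%N.
Definition wD u (l : nat) : word B N := (wprefix u, wlast u, wind u + l)%N.

(* The sequence p stands for "a_(n)": it is empty when a is empty, and it is
   [prefix_of a n] for a D-free word a. Every p is of one of these forms. *)
Definition prefix_of u (n : 'I_N) : seq (B * 'I_N) :=
  rcons (wprefix u) (wlast u, n).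
Definition wcat p v : word B N := (p ++ wprefix v, wlast v, wind v).

Definition wt u : (nat *l (seqlexi (B *l 'I_N) *l (B *l nat)))%type :=
  (wlen u, (wprefix u, (wlast u, wind u))).
Definition wle u v : Prop := (wt u <= wt v)%O.

End Words.

Section GroebnerShirshov.
Context {k : fieldType} {d : Order.disp_t} {B : orderType d} {N : nat}
        {C : assocConformalType k}.
Variable eta : B -> C.
Implicit Types (u v c : word B N) (p : seq (B * 'I_N)) (f g h x : C)
               (S : set C) (e : seq (k * word B N)).

(* b_1(n_1)(b_2(n_2)( ... (b_k(n_k) x) ... )) *)
Definition lprod p x : C := foldr (fun (q : B * 'I_N) y => eta q.1 *_(q.2) y) x p.

Definition nword u : C :=
  lprod (wprefix u) (iter (wind u) cderiv (eta (wlast u))).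

(* e lists the terms of f: nonzero coefficients, pairwise distinct words. *)
Definition expansion f e : Prop :=
  [/\ uniq [seq q.2 | q <- e], forall q, q \in e -> q.1 != 0
    & f = \sum_(q <- e) q.1 *: nword q.2].

Definition supp f : set (word B N) :=
  [set u | exists2 e, expansion f e & u \in [seq q.2 | q <- e]].

Definition Dfree f : Prop := forall u, supp f u -> wDfree u.

Definition lead_term f (a : k) u : Prop :=
  exists e, [/\ expansion f e, (a, u) \in e & forall q, q \in e -> wle q.2 u].

(* [lead f u] reads "f is nonzero and \bar f = u". *)
Definition lead f u : Prop := exists a, lead_term f a u.

Definition monic f : Prop := exists u, lead_term f 1 u.

(* \bar f <= \bar g, where \bar 0 = 0 is smaller than every word. *)
Definition bar_le f g : Prop :=
  forall u, lead f u -> exists2 v, lead g v & wle u v.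

Inductive normal_Sword S : C -> Prop :=
| normal_Sword1 p s u (m : 'I_N) c of S s & lead s u & wDfree u :
    normal_Sword S (lprod p (s *_(m) nword c))
| normal_Sword2 p i s of S s :
    normal_Sword S (lprod p (iter i cderiv s)).

Definition Irr S : set C :=
  [set x | exists2 u, x = nword u & forall y, normal_Sword S y -> ~ lead y u].

Inductive composition S : C -> Prop :=
| comp_inclusion f g u v p (m : 'I_N) c of S f & S g & lead f u & lead g v &
    wDfree v & u = wcat p (wcat (prefix_of v m) c) :
    composition S (f - lprod p (g *_(m) nword c))
| comp_right_inclusion f g u v p i of S f & S g & lead f u & lead g v &
    u = wcat p (wD v i) :
    composition S (f - lprod p (iter i cderiv g))
| comp_intersection f g u v w a c (n m : 'I_N) of S f & S g & lead f u &
    lead g v & wDfree a & wDfree u & w = wcat (prefix_of u m) c &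
    w = wcat (prefix_of a n) v & (wlen w < wlen u + wlen v)%N :
    composition S (f *_(m) nword c - lprod (prefix_of a n) g)
| comp_right_intersection f g u v a (n : 'I_N) i of S f & S g & lead f u &
    lead g v & wDfree a & (0 < i)%N & wD u i = wcat (prefix_of a n) v :
    composition S (iter i cderiv f - lprod (prefix_of a n) g)
| comp_left_mult f b n of S f & (N <= n)%N :
    composition S (eta b *_(n) f)
| comp_right_mult f u b n of S f & lead f u &
    (~ wDfree u /\ (n < N)%N) \/ (~ Dfree f /\ (N <= n)%N) :
    composition S (f *_(n) eta b).

Definition trivial_mod S h : Prop :=
  exists r : seq (k * C),
    (forall q, q \in r -> normal_Sword S q.2 /\ bar_le q.2 h) /\
    h = \sum_(q <- r) q.1 *: q.2.

Definition is_GSB S : Prop :=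
  S `<=` monic /\ forall h, composition S h -> trivial_mod S h.

Definition is_reduced_GSB S : Prop :=
  is_GSB S /\ forall s u, S s -> supp s u -> Irr (S `\ s) (nword u).

End GroebnerShirshov.

Arguments is_free_assoc_conformal {k B} N {C} eta.
Arguments is_reduced_GSB {k d B} N {C} eta S.

(* Main.v *)
Require Import Defs.
From HB Require Import structures.
From mathcomp Require Import all_boot all_order all_algebra.
From mathcomp Require Import boolp classical_sets.
From mathcomp Require Import zify ring.
From mathcomp.multinomials Require Import -(notations) monalg.

(* A normal S-word has the expected leading word, so the leading words of the
   normal S-words are the multiples, in an obvious sense, of the leading words of
   S.  If all compositions of S are trivial then the span of the normal S-words is
   Id(S), and any two of them with the same leading word w differ by a combination
   of normal S-words with leading words below w; hence the leading word of every
   nonzero element of Id(S) is a multiple of the leading word of an element of S.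
   So the elements of a reduced basis are monic elements of the ideal whose
   leading word is minimal among the leading words of the ideal and whose other
   words are not leading words of the ideal.  Two such elements with the same
   leading word agree, since the leading word of their difference would occur in
   one of them.  Conversely, reducing a word at a time constructs
   such an element for every minimal leading word, and together they form a
   Groebner-Shirshov basis.

   That the normal words are linearly independent is read off a model: the
   conformal algebra of polynomials k[X] over the free associative algebra on
   letters b^(j), j < N, where D is multiplication by X and where, with nabla the
   derivation mapping X to 1 and b^(j) to b^(j+1), the product f_(n) g is the
   coefficient of L^n / n! in f(-L) exp(L nabla) g. *)

Set Implicit Arguments.
Unset Strict Implicit.
Unset Printing Implicit Defensive.

Import Order.TTheory GRing.Theory.
Local Open Scope classical_set_scope.
Local Open Scope ring_scope.

(** * The order on words *)

(** At a given length the order compares an index n_j before everything to its right. So when (a_(n)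
    b)_(m) c is expanded by associativity, the terms a_(n-t) (b_(m+t) c) with t > 0 lie below the
    term t = 0, provided that lengths do not grow. The obstacle is the index m+t, which may be N or
    more, where the product is no longer a normal word and has no evident leading word. Products
    with arbitrary indices must therefore be bounded before any leading word can be computed. The
    bounds have the shape [head_le]: the letters of the left factor, then some index below N, then
    some word of the length of the right factor. For normal words they come from the locality of the
    letters. For normal S-words they are what the left and right multiplication compositions supply,
    and the other compositions enter only afterwards, when two normal S-words are compared. *)

Lemma cat_eq_split (T : Type) (s1 t1 s2 t2 : seq T) :
  s1 ++ t1 = s2 ++ t2 -> (size s1 <= size s2)%N ->
  exists2 s, s2 = s1 ++ s & t1 = s ++ t2.
Proof.
elim: s1 s2 => [|a s1 IH] [|a' s2] //= E le; first by exists [::].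
  by exists (a' :: s2).
by case: E => -> /IH[] // s -> ->; exists s.
Qed.

Section WordOrder.
Context {d : Order.disp_t} {B : orderType d} {N : nat}.
Implicit Types (u v r c z : word B N) (p : seq (B * 'I_N)) (q : B * 'I_N).

Definition wlt u v : Prop := (wt u < wt v)%O.

Lemma wleE u v : wle u v <-> u = v \/ wlt u v.
Proof.
rewrite /wle /wlt le_eqVlt; split=> [/orP[/eqP H|]|[->|->]]; rewrite ?eqxx ?orbT //; last by right.
left; case: u v H => -[p b] i [[p' b'] i'].
by rewrite /wt /wlen /wprefix /wlast /wind /= => -[_ -> -> ->].
Qed.

Lemma wle_refl u : wle u u.
Proof. exact: lexx. Qed.

Lemma wle_trans v u z : wle u v -> wle v z -> wle u z.
Proof. exact: le_trans. Qed.

Lemma wlt_le_trans v u z : wlt u v -> wle v z -> wlt u z.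
Proof. exact: lt_le_trans. Qed.

Lemma wle_lt_trans v u z : wle u v -> wlt v z -> wlt u z.
Proof. exact: le_lt_trans. Qed.

Lemma wlt_trans v u z : wlt u v -> wlt v z -> wlt u z.
Proof. exact: lt_trans. Qed.

Lemma wltW u v : wlt u v -> wle u v.
Proof. exact: ltW. Qed.

Lemma wlt_irr u : ~ wlt u u.
Proof. by rewrite /wlt ltxx. Qed.

Lemma wlt_total u v : [\/ u = v, wlt u v | wlt v u].
Proof.
have [/wleE[->|lt]|lt] := leP (wt u) (wt v); 
  [by constructor 1 | by constructor 2 | by constructor 3].
Qed.

Lemma wle_anti u v : wle u v -> wle v u -> u = v.
Proof. by move=> /wleE[//|uv] vu; case: (wlt_irr (wlt_le_trans uv vu)). Qed.

Lemma wle_wlen u v : wle u v -> (wlen u <= wlen v)%N.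
Proof. by rewrite /wle /wt lexi_pair => /andP[]. Qed.

Lemma wlen_wlt u v : (wlen u < wlen v)%N -> wlt u v.
Proof. by rewrite /wlt /wt ltxi_pair leEnat => lt; rewrite ltnW //= leqNgt lt. Qed.

Lemma letter_ltE q q' :
  ((q : B *l 'I_N) < q')%O <-> (q.1 < q'.1)%O \/ q.1 = q'.1 /\ (q.2 < q'.2)%N.
Proof.
case: q q' => b m [b' m'] /=; rewrite ltxi_pair ltEord.
have [bb'|bb'|->] := ltgtP b b'; split => //=; do ?by [left|right].
- by case=> // -[e]; rewrite e ltxx in bb'.
- by case=> [|[]] //; rewrite ltxx.
Qed.

Lemma wlt_nilE b i b' i' : wlt (([::], b, i) : word B N) ([::], b', i') <->
  (b < b')%O \/ b = b' /\ (i < i')%N.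
Proof.
rewrite /wlt /wt /wlen /wprefix /wlast /wind /= !ltxi_pair !lexx /=.
rewrite ltEnat.
have [bb'|bb'|->] := ltgtP b b'; split => //=; do ?by [left|right].
- by case=> // -[e]; rewrite e ltxx in bb'.
- by case=> [|[]] //; rewrite ltxx.
Qed.

(** The weight carries the length once, in front; splitting off the first letter with its index
    turns the order into a recursion, on which the inductions on words below rest. *)
Lemma wlt_consE q p b i q' p' b' i' :
  wlt ((q :: p, b, i) : word B N) (q' :: p', b', i') <->
  (size p < size p')%N \/ size p = size p' /\
   (((q : B *l 'I_N) < q')%O \/ q = q' /\ wlt ((p, b, i) : word B N) (p', b', i')).
Proof.
have [lt|lt|e] := ltngtP (size p) (size p').
- by split=> _; [left | apply: wlen_wlt].
- split=> [H|[//|[e]]]; last by rewrite e ltnn in lt.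
  have /wltW/wle_wlen := H; rewrite /wlen /wprefix /= => le; lia.
- set R := wlt (p, b, i) _; rewrite /wlt /wt /wlen /wprefix /wlast /wind /= e.
  rewrite ltxi_pair lexx /= ltxi_pair /= !lexi_cons.
  have [lt|lt|->] := ltgtP (q : B *l 'I_N) q'.
  + by split=> // _; right; split=> //; left.
  + by split=> // -[//|[_ [//|[eq]]]]; rewrite eq ltxx in lt.
  + have ER : R <-> ((p : seqlexi (B *l 'I_N)) <= p')%O &&
        (((p' : seqlexi (B *l 'I_N)) <= p)%O ==> (((b, i) : B *l nat) < (b', i'))%O).
      by rewrite /R /wlt /wt /wlen /wprefix /wlast /wind /= e ltxi_pair lexx /= ltxi_pair.
    rewrite /=; split=> [H|[//|[_ [//|[_ /ER]]]]] //.
    by right; split=> //; right; split=> //; apply/ER.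
Qed.

(* Otherwise unification unfolds the lexicographic orders and diverges. *)
Opaque wt wlt.

Lemma wcat_wcat p p' u : wcat p (wcat p' u) = wcat (p ++ p') u.
Proof. by rewrite /wcat /wprefix /= catA. Qed.

Lemma wcat0 u : wcat [::] u = u.
Proof. by case: u => -[]. Qed.

Lemma wlen_wcat p u : wlen (wcat p u) = (size p + wlen u)%N.
Proof. by rewrite /wlen /wcat /wprefix /= size_cat addnS. Qed.

Lemma size_prefix_of u m : size (prefix_of u m) = wlen u.
Proof. by rewrite size_rcons. Qed.

Lemma prefix_of_wcat p u m : prefix_of (wcat p u) m = p ++ prefix_of u m.
Proof. by rewrite /prefix_of /= rcons_cat. Qed.

Lemma wcat_prefix_of u m v :
  wcat (prefix_of u m) v = wcat (wprefix u) (wcat [:: (wlast u, m)] v).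
Proof. by rewrite wcat_wcat cats1. Qed.

Lemma prefix_of_nonempty p : p <> [::] -> exists a (n : 'I_N), wDfree a /\ p = prefix_of a n.
Proof.
case/lastP: p => // p [b n] _; exists (p, b, 0%N), n; by [].
Qed.

Lemma wcat_wD p u i : wcat p (wD u i) = wD (wcat p u) i.
Proof. by []. Qed.

Lemma wD_wD u i j : wD (wD u i) j = wD u (i + j).
Proof. by rewrite /wD /= addnA. Qed.

Lemma wD0 u : wD u 0 = u.
Proof. by case: u => -[p b] i; rewrite /wD /= addn0. Qed.

Lemma wlt_cons_lt q q' u v : ((q : B *l 'I_N) < q')%O -> (wlen u <= wlen v)%N ->
  wlt (wcat [:: q] u) (wcat [:: q'] v).
Proof.
move=> qq' le; apply/wlt_consE; move: le; rewrite /wlen ltnS leq_eqVlt.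
by case/orP => [/eqP ->|lt]; [right; split=> //; left | left].
Qed.

Lemma wlt_index b (n n' : 'I_N) u v : (n < n')%N -> (wlen u <= wlen v)%N ->
  wlt (wcat [:: (b, n)] u) (wcat [:: (b, n')] v).
Proof.
by move=> lt; apply: wlt_cons_lt; apply/letter_ltE; right.
Qed.

Lemma wlt_wcat1 q u v : wlt (wcat [:: q] u) (wcat [:: q] v) <-> wlt u v.
Proof.
case: u v => -[p b] i [[p' b'] i']; rewrite /wcat /wprefix /wlast /wind /=.
rewrite wlt_consE ltxx; split=> [[lt|[_ [//|[_]]]]|H] //.
  by apply: wlen_wlt; rewrite /wlen /wprefix /= ltnS.
have := wle_wlen (wltW H); rewrite /wlen /wprefix /= ltnS leq_eqVlt.
by case/orP => [/eqP ->|lt]; [right; split=> //; right | left].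
Qed.

Lemma wlt_wcat p u v : wlt (wcat p u) (wcat p v) <-> wlt u v.
Proof.
elim: p => [|q p IH]; first by rewrite !wcat0.
by rewrite -[q :: p]/([:: q] ++ p) -!wcat_wcat wlt_wcat1.
Qed.

Lemma wcat_inj p : injective (wcat p : word B N -> word B N).
Proof.
move=> [[p1 b1] i1] [[p2 b2] i2]; rewrite /wcat /wprefix /wlast /wind /= => -[].
by move/eqP; rewrite eqseq_cat // eqxx => /eqP -> -> ->.
Qed.

Lemma wle_wcat p u v : wle (wcat p u) (wcat p v) <-> wle u v.
Proof.
rewrite !wleE wlt_wcat; split=> -[E|]; try by right.
- by left; apply: wcat_inj E.
- by left; rewrite E.
Qed.

Lemma wlt_wD i u v : wlt (wD u i) (wD v i) <-> wlt u v.
Proof.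
case: u v => -[p b] j [[p' b'] j']; rewrite /wD /wprefix /wlast /wind /=.
elim: p p' => [|q p IH] [|q' p'].
- by rewrite !wlt_nilE ltn_add2r.
- by split=> _; apply: wlen_wlt.
- by split=> /wltW/wle_wlen.
- by rewrite !wlt_consE IH.
Qed.

Lemma wle_wD i u v : wle u v -> wle (wD u i) (wD v i).
Proof. by rewrite !wleE => -[->|]; [left | right; apply/wlt_wD]. Qed.

Lemma wle_wD_ind u i j : (i <= j)%N -> wle (wD u i) (wD u j).
Proof.
rewrite leq_eqVlt => /orP[/eqP->|lt]; first exact: wle_refl.
apply/wltW; case: u => -[p b] l; rewrite /wD /wprefix /wlast /wind /=.
elim: p => [|q p IH]; last by apply/wlt_consE; right; split=> //; right.
by apply/wlt_nilE; right; rewrite ltn_add2l.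
Qed.

(** As [v] is D-free, the power of D cannot be what makes [u] smaller: the length or the letters
    decide. That decision survives whatever indices and words of equal length are appended. *)
Lemma wlt_prefix_of u v r c (m m' : 'I_N) : wlt u v -> wDfree v -> wlen r = wlen c ->
  wlt (wcat (prefix_of u m) r) (wcat (prefix_of v m') c).
Proof.
rewrite /wDfree => + + Erc; case: u v => -[p b] i [[p' b'] i'] /=.
elim: p p' => [|q p IH] [|q' p'].
- move=> H Ei; move: H; rewrite [i']Ei => /wlt_nilE[lt|[_]]; last by rewrite ltn0.
  apply: wlt_cons_lt; last by rewrite Erc.
  by apply/letter_ltE; left.
- move=> _ _; apply: wlen_wlt.
  by rewrite !wlen_wcat !size_prefix_of Erc ltn_add2r.
- by move/wltW/wle_wlen.
- move=> H Di; have := H => /wlt_consE[lt|[e [lt|[-> {}/IH H']]]].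
  + by apply: wlen_wlt; rewrite !wlen_wcat !size_prefix_of Erc ltn_add2r.
  + apply: (wlt_cons_lt (u := wcat (prefix_of (p, b, i) m) r)
                         (v := wcat (prefix_of (p', b', i') m') c)) => //.
    by rewrite !wlen_wcat !size_prefix_of Erc leq_add2r /wlen /wprefix /= e.
  + apply/(wlt_wcat1 q' (wcat (prefix_of (p, b, i) m) r)
                        (wcat (prefix_of (p', b', i') m') c)).
    exact: H'.
Qed.

(** Without D-freeness [u] and [v] may differ in the power of D alone, which [prefix_of] forgets; so
    only the weak inequality persists. *)
Lemma wle_prefix_of u v r (m : 'I_N) : wle u v ->
  wle (wcat (prefix_of u m) r) (wcat (prefix_of v m) r).
Proof.
case: u v => -[p b] i [[p' b'] i'] /=.
elim: p p' => [|q p IH] [|q' p'].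
- case/wleE => [[-> _]|]; first exact: wle_refl.
  case/wlt_nilE => [lt|[-> _]]; last exact: wle_refl.
  apply/wltW/wlt_cons_lt => //; by apply/letter_ltE; left.
- move=> _; apply/wltW/wlen_wlt.
  by rewrite !wlen_wcat !size_prefix_of ltn_add2r.
- by move/wle_wlen.
- case/wleE => [[-> -> -> _]|]; first exact: wle_refl.
  case/wlt_consE => [lt|[e [lt|[-> H]]]].
  + by apply/wltW/wlen_wlt; rewrite !wlen_wcat !size_prefix_of ltn_add2r.
  + apply/wltW/(wlt_cons_lt (u := wcat (prefix_of (p, b, i) m) r)
                         (v := wcat (prefix_of (p', b', i') m) r)) => //.
    by rewrite !wlen_wcat !size_prefix_of leq_add2r /wlen /wprefix /= e.
  + apply/(wle_wcat [:: q'] (wcat (prefix_of (p, b, i) m) r)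
                            (wcat (prefix_of (p', b', i') m) r)).
    by apply: IH; apply/wltW.
Qed.

Lemma wlt_prefix_index u (n m : 'I_N) v v' : (n < m)%N -> (wlen v <= wlen v')%N ->
  wlt (wcat (prefix_of u n) v) (wcat (prefix_of u m) v').
Proof.
by move=> lt le; rewrite !wcat_prefix_of; apply/wlt_wcat; apply: wlt_index.
Qed.

(** The two clauses are the shapes of the leading words of normal S-words of the second and of the
    first kind, built on an element with leading word [u]. *)
Definition wdivides u v : Prop :=
  (exists p i, v = wcat p (wD u i)) \/
  wDfree u /\ exists p m c, v = wcat p (wcat (prefix_of u m) c).

Lemma wdivides_refl u : wdivides u u.
Proof. by left; exists [::], 0%N; rewrite wD0 wcat0. Qed.

Lemma wdivides_le u v : wdivides u v -> wle u v.
Proof.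
case=> [[p [i ->]]|[_ [p [m [c ->]]]]].
  case: p => [|q p]; last by apply/wltW/wlen_wlt; rewrite wlen_wcat /= addSn ltnS leq_addl.
  by rewrite wcat0 -{1}[u]wD0; apply: wle_wD_ind.
apply/wltW/wlen_wlt; rewrite !wlen_wcat size_prefix_of.
by rewrite addnCA -addn1 leq_add2l addn_gt0 orbT.
Qed.

Lemma wdivides_trans v u z : wdivides u v -> wdivides v z -> wdivides u z.
Proof.
case=> [[p [i ->]]|[uD [p [m [c ->]]]]] [[p' [j ->]]|[vD [p' [n [c' ->]]]]].
- by left; exists (p' ++ p), (i + j)%N; rewrite -wcat_wD wD_wD wcat_wcat.
(* A multiple [wcat p (wD u i)] is D-free only if [i] is 0 and [u] is D-free. *)
- right; split; first by move: vD; rewrite /wDfree /=; lia.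
  exists (p' ++ p), n, c'; rewrite prefix_of_wcat -!wcat_wcat.
  by rewrite -[prefix_of (wD u i) n]/(prefix_of u n).
- right; split=> //; exists (p' ++ p), m, (wD c j).
  by rewrite -!wcat_wD wcat_wcat.
- right; split=> //; exists (p' ++ p), m, (wcat (prefix_of c n) c').
  by rewrite !prefix_of_wcat -!wcat_wcat.
Qed.

Hypothesis B_wf : well_founded (fun x y : B => (x < y)%O).

(** A lexicographic order on sequences is well-founded only for bounded length. Hence the induction
    is on the length, then on the first letter with its index, then on the remaining word. *)
Lemma wlt_wf : well_founded wlt.
Proof.
have letter_wf : well_founded (fun q q' : B * 'I_N => ((q : B *l 'I_N) < q')%O).
  case=> b m; elim/(well_founded_ind B_wf): b m => b IHb m.
  have [s] := ubnP (val m); elim: s m => [|s IHs] m; first by rewrite ltn0.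
  move=> ms; constructor => -[b' m'] /letter_ltE /= [lt|[-> lt]]; first exact: IHb.
  by apply: IHs; apply: leq_trans lt _.
move=> u; have [s] := ubnP (wlen u); elim: s u => [|s IHs] u us; first by rewrite ltn0 in us.
have short v : (wlen v < wlen u)%N -> Acc wlt v.
  by move=> lt; apply: IHs; apply: leq_trans lt _.
case: u us short => -[p b] i us short.
case: p us short => [|q p] us short.
  (* One-letter words: induction on the letter, then on the power of D. *)
  move: us short => _ _.
  elim/(well_founded_ind B_wf): b i => b IHb i.
  have [s'] := ubnP i; elim: s' i => [|s' IHi] i si; first by rewrite ltn0 in si.
  constructor => -[[p' b'] i'] H.
  case: p' H => [/wlt_nilE[lt|[-> lt]]|q' p' /wltW/wle_wlen //]; first exact: IHb.
  by apply: IHi; apply: leq_trans lt _.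
have {us} /(_ q (p, b, i) erefl) : forall q t, size (wprefix t) = size p -> Acc wlt (wcat [:: q] t).
  elim/(well_founded_ind letter_wf) => q' IHq t.
  move=> et; have : Acc wlt t by apply: short; rewrite /wlen et.
  move=> acct; elim: acct et => {}t _ IHt et; constructor => -[[p' b'] i'] H.
  case: t et IHt H => -[pt bt] it /= et IHt.
  case: p' => [|q1 p1] H; first by apply: short.
  have /wlt_consE := H => -[lt|[e1]].
    by apply: short; rewrite /wlen /= -et.
  case=> [lt|[-> lt]].
    by apply: (IHq q1 _ (p1, b', i')) => //=; rewrite e1.
  by apply: (IHt (p1, b', i')) => //=; rewrite e1.
by [].
Qed.

End WordOrder.

(** * A model in which the normal words are linearly independent *)

Section LinearExtension.
Context {k : fieldType} {K : choiceType}.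

Definition mbase (x : K) : malg K k := mkmalgU x 1.

Lemma malg_ind (U : malg K k -> Prop) :
  U 0 -> (forall a x y, U x -> U y -> U (a *: x + y)) ->
  (forall x, U (mbase x)) -> forall f, U f.
Proof.
move=> U0 UD Ub f; rewrite (monalgE f).
elim: (finmap.enum_fset _) => [|x r IH]; first by rewrite big_nil.
rewrite big_cons.
have -> : mkmalgU x (mcoeff x f) = mcoeff x f *: mbase x :> malg K k.
  by apply/malgP => y; rewrite mcoeffZ !mcoeffU mulrnAr mulr1.
exact: UD.
Qed.

Context {V : lmodType k}.
Implicit Types (h : K -> V) (f g : malg K k).

Definition mlift h f : V :=
  \sum_(x <- finmap.enum_fset (msupp f)) mcoeff x f *: h x.

Lemma mlift_linear h : linear (mlift h).
Proof.
have sumE (A : finmap.finset_of (Phant K)) f :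
    finmap.fsubset (msupp f) A ->
    mlift h f = \sum_(x <- finmap.enum_fset A) mcoeff x f *: h x.
  move=> sfA; rewrite [LHS](finmap.big_fset_incl _ sfA) //= => x _ /mcoeff_outdom ->.
  by rewrite scale0r.
move=> a f g.
pose A := finmap.fsetU (finmap.fsetU (msupp f) (msupp g)) (msupp (a *: f + g)).
rewrite !(sumE A); first last.
- exact: finmap.fsubsetUr.
- by apply: (finmap.fsubset_trans (finmap.fsubsetUl _ _)); apply: finmap.fsubsetUl.
- by apply: (finmap.fsubset_trans (finmap.fsubsetUr _ _)); apply: finmap.fsubsetUl.
rewrite scaler_sumr -big_split /=; apply: eq_bigr => x _.
by rewrite mcoeffD mcoeffZ scalerDl scalerA.
Qed.

HB.instance Definition _ h :=
  GRing.isLinear.Build k (malg K k) V *:%R (mlift h) (mlift_linear h).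

Lemma mlift_base h x : mlift h (mbase x) = h x.
Proof.
rewrite /mlift msuppU oner_eq0 finmap.big_seq_fset1 mcoeffUU.
by rewrite scale1r.
Qed.

End LinearExtension.

Section IterLinear.
Context {k : pzRingType} {V : lmodType k} (f : {linear V -> V}).

Lemma iter_linear n : linear (iter n f).
Proof. by elim: n => [|n IH] a x y //=; rewrite IH linearP. Qed.

HB.instance Definition _ n :=
  GRing.isLinear.Build k V V *:%R (iter n f) (iter_linear n).
End IterLinear.

(** * The model, over a space with an abstract basis [e]; [malg] is substituted at the end *)

Section Model.
Context {k : fieldType} {d : Order.disp_t} {B : orderType d} (N : nat).

Local Notation letter := (B * nat)%type.

Context {V : lmodType k} (e : seq letter * nat -> V).
Variables (lift : (seq letter * nat -> V) -> V -> V) (lift_linear : forall h, linear (lift h)).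
Hypothesis lift_e : forall h q, lift h (e q) = h q.
Hypothesis e_ind : forall U : V -> Prop,
  U 0 -> (forall a x y, U x -> U y -> U (a *: x + y)) ->
  (forall q, U (e q)) -> forall f, U f.

HB.instance Definition _ h :=
  GRing.isLinear.Build k V V *:%R (lift h) (lift_linear h).

Implicit Types (w : seq letter) (f g h : V).

(* [e (w, i)] is the product of X^i and of the word [w], whose letter [(b, j)] is
   b^(j). *)
Definition monomial w i : V := e (w, i).

Definition shiftX : V -> V := lift (fun q => monomial q.1 q.2.+1).
Definition lcat w : V -> V := lift (fun q => monomial (w ++ q.1) q.2).

(** The Leibniz rule, by recursion on the word. The letter b^(N) is read as 0, which is the source
    of locality [N]; for [i = 0] the truncated exponent [i.-1] comes with the coefficient 0. *)
Fixpoint nabla_monomial w i : V :=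
  if w is l :: w' then
    (if (l.2.+1 < N)%N then monomial ((l.1, l.2.+1) :: w') i else 0)
      + lcat [:: l] (nabla_monomial w' i)
  else i%:R *: monomial [::] i.-1.

Definition nabla : V -> V := lift (fun q => nabla_monomial q.1 q.2).

HB.instance Definition _ := GRing.Linear.on shiftX.
HB.instance Definition _ w := GRing.Linear.on (lcat w).
HB.instance Definition _ := GRing.Linear.on nabla.

(** In (-L)^i exp(L nabla) g the coefficient of L^n / n! is (-1)^i n!/(n-i)! nabla^(n-i) g. The
    falling factorial replaces the quotient and is 0 for i > n, where the subtraction is
    truncated. *)
Definition model_prod n f g : V :=
  lift (fun q => ((-1) ^+ q.2 * (n ^_ q.2)%:R) *:
                   lcat q.1 (iter (n - q.2) nabla g)) f.

Lemma model_prodPl n g a x y : model_prod n (a *: x + y) g =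
  a *: model_prod n x g + model_prod n y g.
Proof. exact: lift_linear. Qed.

Lemma model_prod0l n g : model_prod n 0 g = 0.
Proof. exact: linear0 (lift _). Qed.

Lemma shiftXP a x y : shiftX (a *: x + y) = a *: shiftX x + shiftX y.
Proof. exact: lift_linear. Qed.

Lemma lcatP w a x y : lcat w (a *: x + y) = a *: lcat w x + lcat w y.
Proof. exact: lift_linear. Qed.

Lemma nablaP a x y : nabla (a *: x + y) = a *: nabla x + nabla y.
Proof. exact: lift_linear. Qed.

Lemma nabla_monomialE w i : nabla (monomial w i) = nabla_monomial w i.
Proof. exact: lift_e. Qed.

Lemma shiftX_monomial w i : shiftX (monomial w i) = monomial w i.+1.
Proof. exact: lift_e. Qed.

Lemma lcat_monomial w w' i : lcat w (monomial w' i) = monomial (w ++ w') i.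
Proof. exact: lift_e. Qed.

Lemma model_prod_monomial n w i g : model_prod n (monomial w i) g =
  ((-1) ^+ i * (n ^_ i)%:R) *: lcat w (iter (n - i) nabla g).
Proof. exact: lift_e. Qed.

Lemma model_prod_monomial0 n w g :
  model_prod n (monomial w 0) g = lcat w (iter n nabla g).
Proof. by rewrite model_prod_monomial mulr1 scale1r subn0. Qed.

Lemma model_ind (U : V -> Prop) :
  U 0 -> (forall a x y, U x -> U y -> U (a *: x + y)) ->
  (forall w, U (monomial w 0)) -> (forall f, U f -> U (shiftX f)) ->
  forall f, U f.
Proof.
move=> U0 UD Uw UX; apply: e_ind => // -[w i].
by elim: i => [|i IH]; [exact: Uw | rewrite -[e _]shiftX_monomial; exact: UX].
Qed.

Lemma model_lin_ext (F G : V -> V) : linear F -> linear G ->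
  (forall w i, F (monomial w i) = G (monomial w i)) -> F =1 G.
Proof.
move=> linF linG FG; apply: e_ind => [|a x y Fx Fy|[w i]].
- have F0 : F 0 = 0 by move: (linF (-1) 0 0); rewrite scaler0 addr0 scaleN1r addNr.
  have G0 : G 0 = 0 by move: (linG (-1) 0 0); rewrite scaler0 addr0 scaleN1r addNr.
  by rewrite F0 G0.
- by rewrite linF linG Fx Fy.
- exact: FG.
Qed.

Lemma lcat_cat w w' f : lcat (w ++ w') f = lcat w (lcat w' f).
Proof.
move: f; apply: model_lin_ext => [|a x y|u i]; first exact: lcatP.
- by rewrite !lcatP.
- by rewrite !lcat_monomial catA.
Qed.

Lemma lcat0 f : lcat [::] f = f.
Proof. by move: f; apply: model_lin_ext => [|//|u i]; [exact: lcatP | rewrite lcat_monomial]. Qed.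

Lemma shiftX_lcat w f : shiftX (lcat w f) = lcat w (shiftX f).
Proof.
move: f; apply: model_lin_ext => [a x y|a x y|u i]; rewrite ?(shiftXP, lcatP) //.
by rewrite !(lcat_monomial, shiftX_monomial).
Qed.

Definition dletter (l : letter) f : V :=
  if (l.2.+1 < N)%N then lcat [:: (l.1, l.2.+1)] f else 0.

Lemma dletter_linear l : linear (dletter l).
Proof.
by move=> a x y; rewrite /dletter; case: ifP => _; rewrite ?lcatP // scaler0 addr0.
Qed.
HB.instance Definition _ l :=
  GRing.isLinear.Build k V V *:%R (dletter l) (dletter_linear l).

Lemma dletterP l a x y : dletter l (a *: x + y) = a *: dletter l x + dletter l y.
Proof. exact: dletter_linear. Qed.

Lemma nabla_lcat1 l f : nabla (lcat [:: l] f) = dletter l f + lcat [:: l] (nabla f).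
Proof.
move: f; apply: model_lin_ext => [a x y|a x y|u i].
- by rewrite lcatP nablaP.
- by rewrite dletterP nablaP lcatP scalerDr addrACA.
- by rewrite lcat_monomial /dletter lcat_monomial !nabla_monomialE.
Qed.

Lemma nabla_monomial_nil i : nabla (monomial [::] i) = i%:R *: monomial [::] i.-1.
Proof. exact: nabla_monomialE. Qed.

(** The commutator of nabla with multiplication by X is the identity, since nabla X = 1 and X is
    central. *)
Lemma nabla_shiftX f : nabla (shiftX f) = shiftX (nabla f) + f.
Proof.
move: f; apply: model_lin_ext => [a x y|a x y|w i].
- by rewrite shiftXP nablaP.
- by rewrite nablaP shiftXP scalerDr addrACA.
elim: w => [|l w IH].
  rewrite shiftX_monomial !nabla_monomial_nil /= linearZ /= shiftX_monomial.
  case: i => [|i]; first by rewrite scale1r scale0r add0r.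
  by rewrite -[X in _ + X]scale1r -scalerDl -[i.+2]addn1 natrD.
rewrite -[l :: w]/([:: l] ++ w) -lcat_monomial shiftX_lcat !nabla_lcat1 IH.
rewrite !linearD /= -shiftX_lcat addrA; congr (_ + _ + _).
by rewrite /dletter; case: ifP => _; rewrite ?linear0 ?shiftX_lcat.
Qed.

Lemma iter_nabla_shiftX n f :
  iter n nabla (shiftX f) = shiftX (iter n nabla f) + n%:R *: iter n.-1 nabla f.
Proof.
elim: n => [|n IH]; first by rewrite scale0r addr0.
rewrite iterS IH linearD linearZ /= nabla_shiftX -addrA; congr (_ + _).
case: n {IH} => [|n] /=; first by rewrite scale0r addr0 scale1r.
by rewrite [n.+2%:R]mulrS scalerDl scale1r.
Qed.

Lemma model_prod_linear_r n f : linear (model_prod n f).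
Proof.
move=> a x y; move: f; elim/e_ind => [|b f g Hf Hg|[w i]].
- by rewrite /= !model_prod0l scaler0 addr0.
- rewrite !model_prodPl /= Hf Hg !scalerDr !scalerA [a * b]mulrC.
  by rewrite -!addrA; congr (_ + _); rewrite addrCA.
- by rewrite -/(monomial w i) !model_prod_monomial !linearP.
Qed.
HB.instance Definition _ n f :=
  GRing.isLinear.Build k V V *:%R (model_prod n f) (model_prod_linear_r n f).

Lemma model_prodS_shiftX n f g :
  model_prod n.+1 (shiftX f) g = - (n.+1%:R *: model_prod n f g).
Proof.
move: f; apply: model_lin_ext => [a x y|a x y|w i].
- by rewrite linearP model_prodPl.
- by rewrite model_prodPl /= scalerDr opprD scalerA mulrC -scalerA scalerN.
- rewrite shiftX_monomial !model_prod_monomial ffactSS subSS scalerA -scaleNr.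
  by rewrite natrM exprS mulN1r !mulNr mulrCA.
Qed.

Lemma model_prod0_shiftX f g : model_prod 0 (shiftX f) g = 0.
Proof.
move: f; apply: (model_lin_ext (G := fun=> 0)) => [a x y|a x y|w i].
- by rewrite linearP model_prodPl.
- by rewrite scaler0 addr0.
- by rewrite shiftX_monomial model_prod_monomial mulr0 scale0r.
Qed.

(** For generating functions this is exp(L nabla) X = (X + L) exp(L nabla). *)
Lemma model_prod_shiftX_r n f g : model_prod n f (shiftX g) =
  shiftX (model_prod n f g) + n%:R *: model_prod n.-1 f g.
Proof.
elim/model_ind: f n => [n|a x y Hx Hy n|w n|f IH n].
- by rewrite /= !model_prod0l linear0 scaler0 addr0.
- rewrite !model_prodPl /= linearP Hx Hy !scalerDr !scalerA.
  by rewrite [_ * a]mulrC addrACA.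
- rewrite !model_prod_monomial0 iter_nabla_shiftX linearD linearZ /=.
  by rewrite shiftX_lcat.
- case: n => [|n]; first by rewrite !model_prod0_shiftX linear0 scaler0 addr0.
  rewrite !model_prodS_shiftX IH scalerDr opprD.
  have -> x : shiftX (- (n.+1%:R *: x)) = - (n.+1%:R *: shiftX x) by rewrite linearN linearZ.
  congr (_ + _).
  case: n => [|n] /=; first by rewrite model_prod0_shiftX scale0r !scaler0 oppr0.
  by rewrite model_prodS_shiftX scalerN !scalerA.
Qed.

Lemma shiftX_model_prod n f g : shiftX (model_prod n f g) =
  model_prod n (shiftX f) g + model_prod n f (shiftX g).
Proof.
rewrite model_prod_shiftX_r; case: n => [|n].
  by rewrite model_prod0_shiftX scale0r addr0 add0r.
by rewrite model_prodS_shiftX /= addrCA addNr addr0.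
Qed.

Lemma model_prod_shiftX n f g :
  model_prod n (shiftX f) g = - (n%:R *: model_prod n.-1 f g).
Proof.
case: n => [|n]; last exact: model_prodS_shiftX.
by rewrite model_prod0_shiftX scale0r oppr0.
Qed.

(** The span of the words without X, encoded as its own induction principle. There [model_prod 0] is
    the product of the free associative algebra, nabla is a derivation of it, and the n-th product
    is a b |-> a nabla^n(b). *)
Definition shiftX_free f := forall U : V -> Prop,
  U 0 -> (forall a x y, U x -> U y -> U (a *: x + y)) ->
  (forall w, U (monomial w 0)) -> U f.

Lemma shiftX_free_monomial w : shiftX_free (monomial w 0).
Proof. by move=> U _ _; apply. Qed.

Lemma shiftX_free0 : shiftX_free 0.
Proof. by move=> U U0. Qed.

Lemma shiftX_freeP a f g :
  shiftX_free f -> shiftX_free g -> shiftX_free (a *: f + g).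
Proof. by move=> Hf Hg U U0 UD Uw; apply: (UD); [apply: Hf | apply: Hg]. Qed.

Lemma shiftX_freeD f g : shiftX_free f -> shiftX_free g -> shiftX_free (f + g).
Proof. by rewrite -[f in f + g]scale1r; apply: shiftX_freeP. Qed.

Lemma shiftX_free_lcat w f : shiftX_free f -> shiftX_free (lcat w f).
Proof.
move=> Hf; pattern f; apply: Hf => [|a x y Hx Hy|v].
- by rewrite linear0; apply: shiftX_free0.
- by rewrite lcatP; apply: shiftX_freeP.
- by rewrite lcat_monomial; apply: shiftX_free_monomial.
Qed.

Lemma shiftX_free_dletter l f : shiftX_free f -> shiftX_free (dletter l f).
Proof.
by rewrite /dletter; case: ifP => _ Hf; [apply: shiftX_free_lcat | apply: shiftX_free0].
Qed.

Lemma shiftX_free_nabla f : shiftX_free f -> shiftX_free (nabla f).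
Proof.
move=> Hf; pattern f; apply: Hf => [|a x y Hx Hy|v].
- by rewrite linear0; apply: shiftX_free0.
- by rewrite nablaP; apply: shiftX_freeP.
- elim: v => [|l v IH].
    by rewrite nabla_monomial_nil scale0r; apply: shiftX_free0.
  rewrite -[l :: v]/([:: l] ++ v) -lcat_monomial nabla_lcat1.
  apply: shiftX_freeD; last exact: shiftX_free_lcat.
  by apply: shiftX_free_dletter; apply: shiftX_free_monomial.
Qed.

Lemma shiftX_free_iter_nabla n f : shiftX_free f -> shiftX_free (iter n nabla f).
Proof. by move=> Hf; elim: n => [//|n]; apply: shiftX_free_nabla. Qed.

Lemma shiftX_free_prod a b :
  shiftX_free a -> shiftX_free b -> shiftX_free (model_prod 0 a b).
Proof.
move=> Ha Hb; pattern a; apply: Ha => [|c x y Hx Hy|w].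
- by rewrite model_prod0l; apply: shiftX_free0.
- by rewrite model_prodPl; apply: shiftX_freeP.
- by rewrite model_prod_monomial0; apply: shiftX_free_lcat.
Qed.

Lemma shiftX_free_prodE n a g :
  shiftX_free a -> model_prod n a g = model_prod 0 a (iter n nabla g).
Proof.
move=> Ha; pattern a; apply: Ha => [|c x y Hx Hy|w].
- by rewrite !model_prod0l.
- by rewrite !model_prodPl Hx Hy.
- by rewrite !model_prod_monomial0.
Qed.

Lemma model_prod_lcat n w f g :
  model_prod n (lcat w f) g = lcat w (model_prod n f g).
Proof.
move: f; apply: model_lin_ext => [a x y|a x y|u i].
- by rewrite lcatP model_prodPl.
- by rewrite model_prodPl lcatP.
- by rewrite lcat_monomial !model_prod_monomial linearZ /= lcat_cat.
Qed.

Lemma shiftX_free_prodA a b h : shiftX_free a ->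
  model_prod 0 (model_prod 0 a b) h = model_prod 0 a (model_prod 0 b h).
Proof.
move=> Ha; pattern a; apply: Ha => [|c x y Hx Hy|w].
- by rewrite !model_prod0l.
- by rewrite !model_prodPl Hx Hy.
- by rewrite !model_prod_monomial0 model_prod_lcat.
Qed.

Lemma nabla_prod a g : shiftX_free a ->
  nabla (model_prod 0 a g) = model_prod 0 (nabla a) g + model_prod 0 a (nabla g).
Proof.
move=> Ha; pattern a; apply: Ha => [|c x y Hx Hy|w].
- by rewrite !(model_prod0l, linear0) addr0.
- by rewrite nablaP !model_prodPl nablaP Hx Hy scalerDr addrACA.
- elim: w => [|l w IH].
    rewrite !model_prod_monomial0 nabla_monomial_nil scale0r model_prod0l.
    by rewrite !lcat0 add0r.
  rewrite -[l :: w]/([:: l] ++ w) -lcat_monomial !model_prod_lcat !nabla_lcat1.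
  rewrite IH linearD /= addrA; congr (_ + _).
  rewrite -[in RHS](scale1r (dletter _ _)) model_prodPl scale1r model_prod_lcat.
  congr (_ + _); rewrite /dletter; case: ifP => _; last by rewrite model_prod0l.
  by rewrite model_prod_lcat.
Qed.

Definition altbin n t : k := (-1) ^+ t * 'C(n, t)%:R.

Lemma altbin_pascal n (F : nat -> V) :
  \sum_(t < n.+2) altbin n.+1 t *: F t =
  \sum_(t < n.+1) altbin n t *: F t - \sum_(t < n.+1) altbin n t *: F t.+1.
Proof.
have -> : \sum_(t < n.+1) altbin n t *: F t = \sum_(t < n.+2) altbin n t *: F t.
  by rewrite [RHS]big_ord_recr /= /altbin bin_small // mulr0 scale0r addr0.
rewrite ![\sum_(t < n.+2) _]big_ord_recl /= -addrA; congr (_ + _).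
  by rewrite /altbin !bin0.
rewrite -sumrB; apply: eq_bigr => t _; rewrite /bump /= add1n -scalerBl.
by congr (_ *: _); rewrite /altbin binS natrD exprS; ring.
Qed.

(** On a product, nabla applied to the first factor only is nabla on the whole minus nabla on the
    second factor. These two operators commute, and the formula is the binomial expansion of the
    n-th power of their difference. *)
Lemma iter_nabla_prod n m b c : shiftX_free b ->
  \sum_(t < n.+1) altbin n t *:
     iter (n - t) nabla (model_prod 0 b (iter (m + t) nabla c)) =
  model_prod 0 (iter n nabla b) (iter m nabla c).
Proof.
move=> Hb; elim: n m => [|n IH] m.
  by rewrite big_ord_recl big_ord0 addr0 /altbin mulr1 scale1r addn0.
pose F t := iter (n.+1 - t) nabla (model_prod 0 b (iter (m + t) nabla c)).
rewrite (altbin_pascal n F).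
have -> : \sum_(t < n.+1) altbin n t *: F t =
          nabla (\sum_(t < n.+1) altbin n t *:
             iter (n - t) nabla (model_prod 0 b (iter (m + t) nabla c))).
  rewrite linear_sum; apply: eq_bigr => t _; rewrite linearZ /= /F.
  by rewrite subSn // -ltnS.
have -> : \sum_(t < n.+1) altbin n t *: F t.+1 =
          \sum_(t < n.+1) altbin n t *:
             iter (n - t) nabla (model_prod 0 b (iter (m.+1 + t) nabla c)).
  by apply: eq_bigr => t _; rewrite /F subSS addnS addSn.
rewrite !IH nabla_prod; last exact: shiftX_free_iter_nabla.
by rewrite -iterS addrK.
Qed.

Lemma model_prodZl n a f g : model_prod n (a *: f) g = a *: model_prod n f g.
Proof. by rewrite -[a *: f]addr0 model_prodPl model_prod0l addr0. Qed.

Lemma model_prodDl n x y g : model_prod n (x + y) g = model_prod n x g + model_prod n y g.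
Proof. by rewrite -[x in LHS]scale1r model_prodPl scale1r. Qed.

(** Both sides change in the same way when [a] or [b] is multiplied by X, which leaves the case of
    two words. *)
Lemma model_prodA n m a b c : model_prod m (model_prod n a b) c =
  \sum_(t < n.+1) altbin n t *: model_prod (n - t) a (model_prod (m + t) b c).
Proof.
elim/model_ind: a n m => [n m|s x y Hx Hy n m|w|a IH n m].
- by rewrite !model_prod0l big1 // => t _; rewrite model_prod0l scaler0.
- rewrite !model_prodPl Hx Hy scaler_sumr -big_split /=.
  by apply: eq_bigr => t _; rewrite model_prodPl scalerDr !scalerA [s * _]mulrC.
- have Hw := shiftX_free_monomial w.
  elim/model_ind: b => [n m|s x y Hx Hy n m|v n m|b IH n m].
  + rewrite linear0 model_prod0l big1 // => t _.
    by rewrite model_prod0l linear0 scaler0.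
  + rewrite linearP /= model_prodPl Hx Hy scaler_sumr -big_split /=.
    apply: eq_bigr => t _.
    by rewrite model_prodPl linearP /= scalerDr !scalerA [s * _]mulrC.
  (* Two words: after removing the common left factor [w] this is [iter_nabla_prod]. *)
  + have Hv := shiftX_free_monomial v.
    have Hnv := shiftX_free_iter_nabla n Hv.
    rewrite [model_prod n _ _]shiftX_free_prodE // shiftX_free_prodE; last first.
      exact: shiftX_free_prod.
    rewrite shiftX_free_prodA // -iter_nabla_prod // linear_sum.
    apply: eq_bigr => t _; rewrite linearZ /= [in RHS]shiftX_free_prodE //.
    by rewrite [model_prod (m + t) _ _]shiftX_free_prodE.
  (* A factor X in [b]: the sums match by (t+1) C(n+1, t+1) = (n+1) C(n, t). *)
  + rewrite model_prod_shiftX_r model_prodDl model_prodZl model_prod_shiftX !IH.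
    under [RHS]eq_bigr => t _ do
      rewrite model_prod_shiftX linearN linearZ /= natrD scalerDl opprD scalerDr
              !scalerN !scalerA.
    rewrite big_split /=; congr (_ + _).
      rewrite scaler_sumr sumrN; congr (- _); apply: eq_bigr => t _.
      rewrite scalerA mulrC; case: m => [|m]; last by rewrite addSn.
      by rewrite !mulr0 !scale0r.
    case: n => [|n] /=.
      by rewrite scale0r big_ord1 mulr0 scale0r oppr0.
    rewrite [RHS]big_ord_recl /= mulr0 scale0r oppr0 add0r scaler_sumr.
    apply: eq_bigr => t _; rewrite /bump /= add1n addnS subSS -scaleNr scalerA.
    congr (_ *: _); rewrite /altbin exprS -!mulrA -natrM [('C(_, _) * _)%N]mulnC.
    by rewrite -mul_bin_diag natrM; ring.
(* A factor X in [a]: the sums match by (n+1-t) C(n+1, t) = (n+1) C(n, t). *)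
- rewrite model_prod_shiftX -scaleNr model_prodZl IH.
  case: n => [|n] /=.
    by rewrite oppr0 scale0r big_ord_recl big_ord0 model_prod0_shiftX scaler0 addr0.
  rewrite [RHS]big_ord_recr /= subnn model_prod0_shiftX scaler0 addr0 scaler_sumr.
  apply: eq_bigr => t _; rewrite subSn -1?ltnS // model_prodS_shiftX -scaleNr.
  rewrite !scalerA; congr (_ *: _); rewrite /altbin.
  rewrite -subSn -1?ltnS //.
  have := mul_bin_down n.+1 t => /(congr1 (fun i => i%:R : k)) /=; rewrite !natrM => E.
  by rewrite !mulNr !mulrN -mulrA [_ * (_ - _)%:R]mulrC -E; ring.
Qed.

Definition nabla_nil f := exists M, iter M nabla f = 0.

Lemma nabla_nil_le f M M' : (M <= M')%N -> iter M nabla f = 0 -> iter M' nabla f = 0.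
Proof. by move=> le E; rewrite -(subnK le) iterD E linear0. Qed.

(** A letter b^(j) can be raised fewer than N - j times before it vanishes, and each factor X is
    lost at the first derivative. For a word the induction is on N - j for the first letter, and
    inside it on the order of nilpotency of the rest. *)
Lemma nabla_nilP f : nabla_nil f.
Proof.
have nilS g : nabla_nil (nabla g) -> nabla_nil g.
  by move=> [M E]; exists M.+1; rewrite iterSr.
have nilD a g h : nabla_nil g -> nabla_nil h -> nabla_nil (a *: g + h).
  move=> [M Eg] [M' Eh]; exists (M + M')%N; rewrite linearP /=.
  rewrite (nabla_nil_le (leq_addr _ _) Eg) (nabla_nil_le (leq_addl _ _) Eh).
  by rewrite scaler0 addr0.
have nil0 : nabla_nil 0 by exists 0%N.
elim/model_ind: f => [//|//|w|f [M E]]; last first.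
  exists M.+1; rewrite iter_nabla_shiftX /= E !linear0.
  by rewrite addr0.
elim: w => [|l w IH]; first by exists 1%N; rewrite /= nabla_monomial_nil scale0r.
rewrite -[l :: w]/([:: l] ++ w) -lcat_monomial.
move: (monomial w 0) IH => g nilg; have [r] := ubnP (N - l.2).
elim: r l g nilg => // r IHr l g [M]; elim: M g => [|M IHM] g Eg lt.
  by exists 0%N; move: Eg => /= ->; rewrite linear0.
apply: nilS; rewrite nabla_lcat1 -[dletter _ _]scale1r; apply: (nilD).
  rewrite /dletter; case: ifP => // lN; apply: IHr => /=; last by lia.
  by exists M.+1.
by apply: IHM => //; rewrite -iterSr.
Qed.

Lemma model_prod_locality f g : exists M, forall n, (M <= n)%N -> model_prod n f g = 0.
Proof.
elim/model_ind: f => [|a x y [M HM] [M' HM']|w|f [M HM]].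
- by exists 0%N => n _; rewrite model_prod0l.
- exists (M + M')%N => n le; rewrite model_prodPl HM; last first.
    by apply: leq_trans le; apply: leq_addr.
  by rewrite HM' ?scaler0 ?addr0 //; apply: leq_trans le; apply: leq_addl.
- have [M E] := nabla_nilP g; exists M => n le.
  by rewrite model_prod_monomial0 (nabla_nil_le le E) linear0.
- exists M.+1 => -[|n] // le; rewrite model_prodS_shiftX HM //.
  by rewrite scaler0 oppr0.
Qed.

(* For [N = 0] all products of generators have to vanish. *)
Definition cut_prod n f g : V := if (0 < N)%N then model_prod n f g else 0.

Lemma cut_prod_linear_l n g : linear (cut_prod n ^~ g).
Proof.
rewrite /cut_prod => a x y; case: (0 < N)%N; first exact: model_prodPl.
by rewrite scaler0 addr0.
Qed.

Lemma cut_prod_linear_r n f : linear (cut_prod n f).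
Proof.
rewrite /cut_prod => a x y; case: (0 < N)%N; first exact: model_prod_linear_r.
by rewrite scaler0 addr0.
Qed.

Lemma cut_prod_locality f g : exists M, forall n, (M <= n)%N -> cut_prod n f g = 0.
Proof.
have [M HM] := model_prod_locality f g.
by exists M => n /HM; rewrite /cut_prod; case: (0 < N)%N.
Qed.

Lemma shiftX_cut_prod n f g :
  shiftX (cut_prod n f g) = cut_prod n (shiftX f) g + cut_prod n f (shiftX g).
Proof.
rewrite /cut_prod; case: (0 < N)%N; first exact: shiftX_model_prod.
by rewrite linear0 addr0.
Qed.

Lemma cut_prodS_shiftX n f g :
  cut_prod n.+1 (shiftX f) g = - (n.+1%:R *: cut_prod n f g).
Proof.
rewrite /cut_prod; case: (0 < N)%N; first exact: model_prodS_shiftX.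
by rewrite scaler0 oppr0.
Qed.

Lemma cut_prod0_shiftX f g : cut_prod 0 (shiftX f) g = 0.
Proof. by rewrite /cut_prod model_prod0_shiftX if_same. Qed.

Lemma cut_prodA n m a b c : cut_prod m (cut_prod n a b) c =
  \sum_(t < n.+1) altbin n t *: cut_prod (n - t) a (cut_prod (m + t) b c).
Proof.
rewrite /cut_prod; case: (0 < N)%N; first exact: model_prodA.
by rewrite big1 // => t _; rewrite scaler0.
Qed.

Definition model_conformal : conformalType k := HB.pack V
  (@isConformal.Build k V shiftX cut_prod shiftXP cut_prod_linear_l
     cut_prod_linear_r cut_prod_locality shiftX_cut_prod cut_prodS_shiftX
     cut_prod0_shiftX).

Definition model_algebra : assocConformalType k := HB.pack
  (Conformal.sort model_conformal)
  (@Conformal_isAssoc.Build k model_conformal cut_prodA).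

Definition model_gen (b : B) : model_algebra := monomial [:: (b, 0%N)] 0.


Lemma iter_nabla_letter b m : (m < N)%N ->
  iter m nabla (monomial [:: (b, 0%N)] 0) = monomial [:: (b, m)] 0.
Proof.
elim: m => [//|m IH] lt; rewrite iterS IH; last by apply: ltnW.
by rewrite nabla_monomialE /= lt scale0r linear0 addr0.
Qed.

Lemma model_gen_locality : has_locality N model_gen.
Proof.
move=> b b' n Nn; rewrite /cprod /= /cut_prod; case: ifP => // N0.
rewrite model_prod_monomial0 (@nabla_nil_le _ N) ?linear0 //.
rewrite -(prednK N0) iterS iter_nabla_letter ?prednK //.
by rewrite nabla_monomialE /= prednK // ltnn scale0r linear0 addr0.
Qed.

Fixpoint model_word (p : seq (B * 'I_N)) b i : V :=
  if p is q :: p' then lcat [:: (q.1, 0%N)] (iter q.2 nabla (model_word p' b i))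
  else lcat [:: (b, 0%N)] (monomial [::] i).

Lemma nword_model (u : word B N) :
  nword model_gen u = model_word (wprefix u) (wlast u) (wind u).
Proof.
case: u => -[p b] i; rewrite /nword /wprefix /wlast /wind /=.
elim: p => [|[b' n] p IH] /=.
  by elim: i => [|i IH]; rewrite ?lcat_monomial // iterS IH lcat_monomial [LHS]shiftX_monomial.
(* The index [n : 'I_N] witnesses that [N] is positive, so the product is not cut. *)
by rewrite IH /cprod /= /cut_prod (leq_trans _ (ltn_ord n)) // model_prod_monomial0.
Qed.

Variable coef : seq letter * nat -> V -> k.
Hypothesis coef_linear : forall q, scalar (coef q).
Hypothesis coef_e : forall q q', coef q (e q') = (q' == q)%:R.

HB.instance Definition _ q :=
  GRing.isLinear.Build k V k *%R (coef q) (coef_linear q).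

Lemma coef_lcat_nil l i y : coef ([::], i) (lcat [:: l] y) = 0.
Proof.
elim/e_ind: y => [|a x y Hx Hy|[w j]]; first by rewrite !linear0.
- by rewrite lcatP coef_linear Hx Hy mulr0 addr0.
- by rewrite -/(monomial w j) lcat_monomial coef_e.
Qed.

Lemma coef_lcat_cons l l' w i y :
  coef (l' :: w, i) (lcat [:: l] y) = if l == l' then coef (w, i) y else 0.
Proof.
elim/e_ind: y => [|a x y Hx Hy|[v j]]; first by rewrite !linear0 if_same.
- rewrite lcatP !coef_linear Hx Hy; case: ifP => // _; by rewrite mulr0 addr0.
- rewrite -/(monomial v j) lcat_monomial !coef_e !xpair_eqE eqseq_cons.
  by case: (l == l').
Qed.

Lemma coef_iter_nil m l i y : coef ([::], i) (iter m nabla (lcat [:: l] y)) = 0.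
Proof.
elim: m l y => [|m IH] l y; first exact: coef_lcat_nil.
rewrite iterSr nabla_lcat1 !linearD /= IH addr0 /dletter; case: ifP => // _.
by rewrite !linear0.
Qed.

(** By the Leibniz rule each of the [m] derivatives either raises the first letter or falls on [y];
    [j] counts the latter. *)
Lemma coef_iter_cons m l l' w i y :
  coef (l' :: w, i) (iter m nabla (lcat [:: l] y)) != 0 ->
  l'.1 = l.1 /\ exists2 j, (l'.2 + j = l.2 + m)%N & coef (w, i) (iter j nabla y) != 0.
Proof.
elim: m l y => [|m IH] l y.
  rewrite /= coef_lcat_cons; case: (l =P l') => [->|_]; last by rewrite eqxx.
  by split=> //; exists 0%N.
rewrite iterSr nabla_lcat1 !linearD /= /dletter.
case: ifP => [lt|_]; last first.
  rewrite !linear0 add0r => /IH[-> [j Ej nz]]; split=> //; exists j.+1.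
    by rewrite addnS Ej addnS.
  by rewrite iterSr.
have [->|nz _] := eqVneq (coef (l' :: w, i) (iter m nabla (lcat [:: (l.1, l.2.+1)] y))) 0.
  rewrite add0r => /IH[-> [j Ej nz]]; split=> //; exists j.+1.
    by rewrite addnS Ej addnS.
  by rewrite iterSr.
by have [-> [j Ej nz']] := IH _ _ nz; split=> //; exists j; rewrite // Ej addnS.
Qed.

(** Exactly one Leibniz term puts all [m] derivatives on the first letter, and its coefficient is 1.
    The bound is asked only for positive [m], so that [m = 0] is covered when [N] is 0. *)
Lemma coef_iter_top m b a w i y : ((0 < m)%N -> (a + m < N)%N) ->
  coef ((b, (a + m)%N) :: w, i) (iter m nabla (lcat [:: (b, a)] y)) = coef (w, i) y.
Proof.
elim: m a y => [|m IH] a y lt; first by rewrite /= coef_lcat_cons addn0 eqxx.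
rewrite iterSr nabla_lcat1 !linearD /= /dletter /=.
have -> : (a.+1 < N)%N by apply: leq_ltn_trans (lt erefl); rewrite addnS ltnS leq_addr.
rewrite -addSnnS IH => [|_]; last by rewrite addSnnS; exact: lt.
have [->|nz] := eqVneq (coef ((b, (a.+1 + m)%N) :: w, i)
  (iter m nabla (lcat [:: (b, a)] (nabla y)))) 0; first by rewrite addr0.
by case: (coef_iter_cons nz) => _ [j /=]; lia.
Qed.

(** The monomial that identifies a normal word: each index n_j is passed on to the next letter,
    giving b_1^(0) b_2^(n_1) ... b_(k+1)^(n_k) for [m = 0]. The argument [m] is the number of
    derivatives arriving from the left. *)
Fixpoint lead_letters m (p : seq (B * 'I_N)) b : seq letter :=
  if p is q :: p' then (q.1, m) :: lead_letters q.2 p' b else [:: (b, m)].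

Lemma coef_model_word m p b i : ((0 < m)%N -> (m < N)%N) ->
  coef (lead_letters m p b, i) (iter m nabla (model_word p b i)) = 1.
Proof.
elim: p m => [|q p IH] m lt /=.
  by rewrite (@coef_iter_top m b 0) // coef_e eqxx.
by rewrite (@coef_iter_top m q.1 0) // IH.
Qed.

Lemma coef_iter_const j i' i :
  coef ([::], i') (iter j nabla (monomial [::] i)) != 0 -> (i' + j = i)%N.
Proof.
elim: j i => [|j IH] i.
  by rewrite coef_e xpair_eqE /= addn0; have [->|_] := eqVneq i i'; rewrite ?eqxx.
rewrite iterSr nabla_monomial_nil !linearZ /=.
case: i => [|i]; first by rewrite mul0r eqxx.
by rewrite mulf_eq0 negb_or => /andP[_ /IH]; rewrite addnS => /= ->.
Qed.

(** The first letter absorbs m' of the [m] derivatives. If it absorbs fewer than [m], the index in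
    front already decides the comparison; if it absorbs all, none is left for the rest and the
    induction applies there. *)
Lemma coef_model_word_le m p b i m' p' b' i' :
  coef (lead_letters m' p' b', i') (iter m nabla (model_word p b i)) != 0 ->
  size p' = size p /\
  ((m' < m)%N \/ m' = m /\ wle ((p', b', i') : word B N) (p, b, i)).
Proof.
have lead_lettersE m1 p1 : exists l w, lead_letters m1 p1 b' = l :: w.
  by case: p1 => [|q p1]; do 2!eexists; reflexivity.
elim: p m m' p' => [|q p IH] m m' [|q' p'] /=.
- move/coef_iter_cons => /= [-> [j Ej /coef_iter_const Ei]]; split=> //.
  have [Em|lt] : m' = m \/ (m' < m)%N by lia.
    right; split=> //; have -> : i' = i by lia.
    exact: wle_refl.
  by left.
- case/coef_iter_cons => _ [j _]; have [l [w ->]] := lead_lettersE q'.2 p'.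
  elim: j i => [|j IHj] i0; first by rewrite coef_e eqxx.
  rewrite iterSr nabla_monomial_nil !linearZ /= mulf_eq0 negb_or.
  by case/andP => _ /IHj.
- case/coef_iter_cons => _ [j _]; rewrite -iterD; case: p {IH} => [|q1 p] /=;
  by rewrite coef_iter_nil eqxx.
- case/coef_iter_cons => /= Eq [j Ej]; rewrite -iterD => /IH[Es H].
  split; first by rewrite Es.
  have [j0|j0] := posnP j; last by left; lia.
  right; split; first by lia.
  move: H; rewrite j0 add0n; case: q q' Eq {Ej} => [c n] [c' n'] /= -> H.
  case: H => [lt|[En le]].
    apply/wltW; rewrite -[(_ :: p', _, _)]/(wcat [:: (c, n')] (p', b', i')).
    rewrite -[(_ :: p, _, _)]/(wcat [:: (c, n)] (p, b, i)).
    by apply: wlt_index; rewrite // /wlen /= Es.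
  by rewrite (val_inj En); apply/(wle_wcat [:: (c, n)] (p', b', i') (p, b, i)).
Qed.

End Model.

(** Functionals that are unitriangular on the images of the normal words; this is all that linear
    independence requires of the model. *)
Lemma exists_dual_model (k : fieldType) (d : Order.disp_t) (B : orderType d) (N : nat) :
  exists (A : assocConformalType k) (eps : B -> A) (tau : word B N -> A -> k),
  [/\ has_locality N eps, forall v, scalar (tau v),
      forall v, tau v (nword eps v) = 1
    & forall u v, wlt u v -> tau v (nword eps u) = 0].
Proof.
pose K : choiceType := (seq (B * nat) * nat)%type.
pose A := @model_algebra k d B N (malg K k) mbase mlift mlift_linear mlift_base malg_ind.
exists A, (@model_gen k d B N (malg K k) mbase mlift mlift_linear mlift_base malg_ind).
exists (fun v => mcoeff (lead_letters 0 (wprefix v) (wlast v), wind v)).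
have coef_linear (q : K) : scalar (mcoeff q : malg K k -> k).
  by move=> a x y; rewrite mcoeffD mcoeffZ.
have coef_e (q q' : K) : mcoeff q (mbase q' : malg K k) = (q' == q)%:R.
  by rewrite mcoeffU.
split=> [|v|v|u v uv].
- exact: model_gen_locality.
- exact: coef_linear.
- rewrite nword_model.
  exact: (@coef_model_word _ _ _ _ _ _ _ mlift_linear mlift_base malg_ind _ coef_linear coef_e 0).
- apply: contra_notP (wlt_irr (u := v)) => /eqP nz.
  move: nz; rewrite nword_model => nz.
  have := @coef_model_word_le _ _ _ _ _ _ _ mlift_linear mlift_base malg_ind _ coef_linear coef_e 0 _ _ _ 0 _ _ _ nz.
  case=> _ [//|[_ le]]; case: u v uv le {nz} => -[p b] i [[p' b'] i'] uv le.
  exact: wle_lt_trans le uv.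
Qed.

(** * Spans of products of generators *)

Section Span.
Context {k : pzRingType} {V : lmodType k}.
Implicit Types (U G : set V) (x y : V).

Definition subspace U := U 0 /\ forall a x y, U x -> U y -> U (a *: x + y).

Inductive span G : V -> Prop :=
| span0 : span G 0
| span_cons a x y of G x & span G y : span G (a *: x + y).

Lemma span_subspace G : subspace (span G).
Proof.
split=> [|a x y Gx Gy]; first exact: span0.
elim: Gx => [|b x1 x2 Gx1 _ IH]; first by rewrite scaler0 add0r.
by rewrite scalerDr scalerA -addrA; apply: span_cons.
Qed.

Lemma span_gen G x : G x -> span G x.
Proof. by move=> Gx; rewrite -[x]addr0 -[x]scale1r; apply: span_cons Gx (span0 _). Qed.

Lemma span_min G U : subspace U -> (forall x, G x -> U x) -> forall x, span G x -> U x.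
Proof. by move=> [U0 UD] GU x; elim=> [//|a {}x y /GU Ux _ Uy]; apply: UD. Qed.

Lemma subspace0 U : subspace U -> U 0. Proof. by case. Qed.

Lemma subspaceD U x y : subspace U -> U x -> U y -> U (x + y).
Proof. by move=> [_ UD] Ux Uy; rewrite -[x]scale1r; apply: UD. Qed.

Lemma subspaceZ U a x : subspace U -> U x -> U (a *: x).
Proof. by move=> [U0 UD] Ux; rewrite -[_ *: _]addr0; apply: UD. Qed.

Lemma subspaceN U x : subspace U -> U x -> U (- x).
Proof. by move=> subU Ux; rewrite -scaleN1r; apply: subspaceZ. Qed.

Lemma subspaceB U x y : subspace U -> U x -> U y -> U (x - y).
Proof. by move=> subU Ux Uy; apply: subspaceD => //; apply: subspaceN. Qed.

Lemma subspace_sum U (I : eqType) (r : seq I) (F : I -> V) : subspace U ->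
  (forall i, i \in r -> U (F i)) -> U (\sum_(i <- r) F i).
Proof.
move=> subU; elim: r => [|i r IH] Ur; first by rewrite big_nil; apply: subspace0.
rewrite big_cons; apply: subspaceD => //; first by apply: Ur; rewrite mem_head.
by apply: IH => j jr; apply: Ur; rewrite inE jr orbT.
Qed.

Lemma span_seq G x : span G x ->
  exists r : seq (k * V), (forall q, q \in r -> G q.2) /\ x = \sum_(q <- r) q.1 *: q.2.
Proof.
move: x; apply: span_min => [|x Gx]; last first.
  exists [:: (1, x)]; split; last by rewrite big_seq1 scale1r.
  by move=> q; rewrite inE => /eqP ->.
split=> [|a _ _ [r [Hr ->]] [s [Hs ->]]]; first by exists [::]; rewrite big_nil.
exists ([seq (a * q.1, q.2) | q <- r] ++ s); split=> [q|].
  by rewrite mem_cat => /orP[/mapP[q' /Hr ? ->]|/Hs].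
rewrite big_cat big_map scaler_sumr /=; congr (_ + _).
by apply: eq_bigr => q _; rewrite scalerA.
Qed.

End Span.

Lemma subspace_preim (k : pzRingType) (V W : lmodType k) (f : V -> W) (U : set W) :
  linear f -> subspace U -> subspace (fun x => U (f x)).
Proof.
move=> linf [U0 UD]; split=> [|a x y Ux Uy]; last by rewrite linf; apply: UD.
have -> // : f 0 = 0.
by move: (linf (-1) 0 0); rewrite scaler0 addr0 scaleN1r addNr.
Qed.

Lemma span_image (k : pzRingType) (V W : lmodType k) (f : V -> W) (G : set V) (U : set W) :
  linear f -> subspace U -> (forall x, G x -> U (f x)) ->
  forall x, span G x -> U (f x).
Proof. by move=> linf subU GU; apply: span_min => //; apply: subspace_preim. Qed.

Section ConformalTheory.
Context {k : fieldType}.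

Section Basic.
Context {C : conformalType k}.
Implicit Types (a b c x y : C).

HB.instance Definition _ :=
  GRing.isLinear.Build k C C *:%R (@cderiv k C) (@cderiv_linear k C).
HB.instance Definition _ n a :=
  GRing.isLinear.Build k C C *:%R (cprod n a) (cprod_linear_r n a).

Lemma cprodPl n s x y b : (s *: x + y) *_(n) b = s *: (x *_(n) b) + y *_(n) b.
Proof. exact: cprod_linear_l. Qed.

Lemma cprod0l n b : (0 : C) *_(n) b = 0.
Proof.
by move: (cprodPl n (-1) 0 0 b); rewrite scaler0 addr0 scaleN1r addNr.
Qed.

Lemma cprodDl n x y b : (x + y) *_(n) b = x *_(n) b + y *_(n) b.
Proof. by rewrite -[x in LHS]scale1r cprodPl scale1r. Qed.

Lemma cprodBl n x y b : (x - y) *_(n) b = x *_(n) b - y *_(n) b.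
Proof. by rewrite addrC -scaleN1r cprodPl scaleN1r addrC. Qed.

Lemma cprod_derivl n a b : cderiv a *_(n) b = - (n%:R *: (a *_(n.-1) b)).
Proof.
case: n => [|n]; last exact: cprodS_deriv_l.
by rewrite cprod0_deriv_l scale0r oppr0.
Qed.

Lemma cprod_derivr n a b :
  a *_(n) cderiv b = cderiv (a *_(n) b) + n%:R *: (a *_(n.-1) b).
Proof. by rewrite cderiv_prod cprod_derivl addrAC addNr add0r. Qed.

(** A power of D on a left factor only costs a scalar and a change of the index, so it is harmless
    wherever every index is allowed. *)
Lemma cprod_iter_derivl i n a b :
  exists s m, iter i cderiv a *_(n) b = s *: (a *_(m) b).
Proof.
elim: i n => [|i IH] n; first by exists 1, n; rewrite scale1r.
have [s [m E]] := IH n.-1; exists (- n%:R * s), m.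
by rewrite iterS cprod_derivl E -scaleNr scalerA.
Qed.

End Basic.

Section Assoc.
Context {C : assocConformalType k}.
Implicit Types (a b c x y : C).

(** All terms but t = 0 of the associativity formula have a left index below [n]; nothing is said
    about their inner index, hence the hypothesis for every [j]. *)
Lemma cprodA_top (U : set C) n m a b c : subspace U ->
  (forall i j, (i < n)%N -> U (a *_(i) (b *_(j) c))) ->
  U ((a *_(n) b) *_(m) c - a *_(n) (b *_(m) c)).
Proof.
move=> subU H; rewrite cprodA big_ord_recl /= subn0 addn0 mul1r bin0 scale1r.
rewrite addrAC subrr add0r; apply: subspace_sum => // t _.
by apply: subspaceZ => //; apply: H; rewrite /bump /= add1n; have := ltn_ord t; lia.
Qed.

Lemma cprodA_sub (U : set C) n m a b c : subspace U ->
  (forall i j, (i <= n)%N -> U (a *_(i) (b *_(j) c))) ->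
  U ((a *_(n) b) *_(m) c).
Proof.
move=> subU H; rewrite -[X in U X](subrK (a *_(n) (b *_(m) c))).
apply: subspaceD => //; last exact: H.
by apply: cprodA_top => // i j /ltnW; apply: H.
Qed.

(** The associativity formula is solved for its term t = 0, and the remaining terms are treated by
    induction on the left index. *)
Lemma cprodA_sub_rev (U : set C) n m a b c : subspace U ->
  (forall i j, (i <= n)%N -> U ((a *_(i) b) *_(j) c)) ->
  U (a *_(n) (b *_(m) c)).
Proof.
move=> subU; have [s] := ubnP n; elim: s n m => // s IH n m lt H.
rewrite -[X in U X](subrK ((a *_(n) b) *_(m) c)); apply: subspaceD => //; last exact: H.
rewrite -opprB; apply: subspaceN => //; apply: cprodA_top => // i j lti.
by apply: IH => [|i' j' le]; [lia | apply: H; lia].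
Qed.

End Assoc.
End ConformalTheory.

Section WordSpans.
Context {k : fieldType} {d : Order.disp_t} {B : orderType d} {N : nat}.
Context {C : assocConformalType k} (eta : B -> C).
Hypothesis eta_loc : has_locality N eta.
Implicit Types (u v w z r c : word B N) (p : seq (B * 'I_N)) (q : B * 'I_N).
Implicit Types (x y f g : C) (P : set (word B N)).

Local Notation lprod := (lprod eta).
Local Notation nword := (nword eta).

Lemma lprod_linear p : linear (lprod p).
Proof. by elim: p => [|q p IH] a x y //=; rewrite IH linearP. Qed.

HB.instance Definition _ p :=
  GRing.isLinear.Build k C C *:%R (lprod p) (lprod_linear p).

Lemma lprod_cat p p' x : lprod (p ++ p') x = lprod p (lprod p' x).
Proof. exact: foldr_cat. Qed.

Lemma nword_wcat p u : nword (wcat p u) = lprod p (nword u).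
Proof. exact: lprod_cat. Qed.

Definition wletter b : word B N := ([::], b, 0%N).

(* The words bounded by some [u_(m) r] where [r] has [l] letters: this bounds the
   words occurring in products [[u]_(n) x] for arbitrarily large [n]. *)
Definition head_le u l : set (word B N) :=
  fun z => exists m r, wlen r = l /\ wle z (wcat (prefix_of u m) r).

Lemma head_le_down u l z z' : wle z z' -> head_le u l z' -> head_le u l z.
Proof. by move=> le [m [r [Er le']]]; exists m, r; split=> //; apply: wle_trans le'. Qed.

Lemma head_le_wD u l z : head_le u l z -> head_le u l (wD z 1).
Proof.
move=> [m [r [Er le]]]; exists m, (wD r 1); split; first by rewrite -Er.
by rewrite wcat_wD; apply: wle_wD.
Qed.

Lemma head_le_mono u u' l z : wle u u' -> head_le u l z -> head_le u' l z.
Proof.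
move=> le [m [r [Er lez]]]; exists m, r; split=> //.
exact: wle_trans (wle_prefix_of _ _ le).
Qed.

Lemma head_le_trans u z (y : word B N) l l' :
  head_le u l z -> head_le z l' y -> head_le u (l + l') y.
Proof.
move=> [m [r [<- lez]]] [m' [r' [<- ley]]]; exists m, (wcat (prefix_of r m') r').
split; first by rewrite wlen_wcat size_prefix_of.
apply: wle_trans ley _; apply: wle_trans (wle_prefix_of _ _ lez) _.
by rewrite prefix_of_wcat wcat_wcat; apply: wle_refl.
Qed.

Lemma head_le_cons q u l z : head_le u l z -> head_le (wcat [:: q] u) l (wcat [:: q] z).
Proof.
move=> [m [r [Er le]]]; exists m, r; split=> //.
by rewrite prefix_of_wcat -wcat_wcat; apply/wle_wcat.
Qed.

Lemma head_le_cons_le b (n n' : 'I_N) u l z : (n' <= n)%N ->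
  head_le u l z -> head_le (wcat [:: (b, n)] u) l (wcat [:: (b, n')] z).
Proof.
rewrite leq_eqVlt => /orP[/eqP/val_inj ->|lt]; first exact: head_le_cons.
move/(head_le_cons (b, n)); apply: head_le_down.
by apply/wltW/wlt_index.
Qed.

Lemma head_le_wcat p u l z : head_le u l z -> head_le (wcat p u) l (wcat p z).
Proof.
elim: p => [|q p IH] H; first by rewrite !wcat0.
by rewrite -!(wcat_wcat [:: q] p); apply: head_le_cons; apply: IH.
Qed.

Lemma head_le_prefix u (m n : 'I_N) v l z : (n <= m)%N -> head_le v l z ->
  head_le (wcat (prefix_of u m) v) l (wcat (prefix_of u n) z).
Proof.
move=> le H; rewrite !wcat_prefix_of; apply: head_le_wcat.
exact: head_le_cons_le.
Qed.

Lemma head_le_letter q z : head_le (wletter q.1) (wlen z) (wcat [:: q] z).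
Proof. by exists q.2, z; split=> //; case: q => b n; apply: wle_refl. Qed.

Lemma head_le_letterS q b l z :
  head_le (wletter b) l z -> head_le (wletter q.1) l.+1 (wcat [:: q] z).
Proof.
move=> [m [r [Er le]]]; exists q.2, (wcat (prefix_of (wletter b) m) r).
split; first by rewrite wlen_wcat size_prefix_of Er.
by case: q => b' n; apply/(wle_wcat [:: (b', n)]).
Qed.

Lemma head_le_len b l l' z :
  (l <= l')%N -> head_le (wletter b) l z -> head_le (wletter b) l' z.
Proof.
move=> le [m [r [Er lez]]]; exists m, (wcat (nseq (l' - l) (b, m)) r).
split; first by rewrite wlen_wcat size_nseq Er subnK.
apply: wle_trans lez _; move: le; rewrite leq_eqVlt => /orP[/eqP ->|lt].
  by rewrite subnn wcat0; apply: wle_refl.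
apply/wltW/wlen_wlt; rewrite !wlen_wcat size_nseq; lia.
Qed.

Lemma head_le_lt u v l z c (m : 'I_N) : wlt u v -> wDfree v -> wlen c = l ->
  head_le u l z -> wlt z (wcat (prefix_of v m) c).
Proof.
move=> lt vD Ec [m' [r [Er le]]]; apply: wle_lt_trans le _.
by apply: wlt_prefix_of; rewrite // Er.
Qed.

Lemma head_le_self u c (m : 'I_N) : head_le u (wlen c) (wcat (prefix_of u m) c).
Proof. by exists m, c; split=> //; apply: wle_refl. Qed.

(** * Generators with leading words, to be the normal words or the normal S-words *)

Section Generators.
(* [X w x] holds when [x] is a generator with leading word [w]. *)
Variable X : word B N -> set C.

Definition gspan P : set C := span (fun x => exists2 w, X w x & P w).

Lemma gspan_subspace P : subspace (gspan P).
Proof. exact: span_subspace. Qed.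
Hint Resolve gspan_subspace : core.

Lemma gspan0 P : gspan P 0. Proof. exact: subspace0. Qed.

Lemma gspanD P x y : gspan P x -> gspan P y -> gspan P (x + y).
Proof. exact: subspaceD. Qed.

Lemma gspanN P x : gspan P x -> gspan P (- x). Proof. exact: subspaceN. Qed.

Lemma gspanB P x y : gspan P x -> gspan P y -> gspan P (x - y).
Proof. exact: subspaceB. Qed.

Lemma gspanZ P a x : gspan P x -> gspan P (a *: x).
Proof. exact: subspaceZ. Qed.

Lemma gspan_gen P w x : X w x -> P w -> gspan P x.
Proof. by move=> Xx Pw; apply: span_gen; exists w. Qed.

Lemma gspan_linear P (U : set C) (F : C -> C) : linear F -> subspace U ->
  (forall w x, X w x -> P w -> U (F x)) -> forall x, gspan P x -> U (F x).
Proof. by move=> linF subU H; apply: span_image => // x [w Xx Pw]; apply: H Xx Pw. Qed.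

Lemma gspan_sub P P' : (forall w, P w -> P' w) -> forall x, gspan P x -> gspan P' x.
Proof.
by move=> PP'; apply: (@gspan_linear P _ id) => // w x Xx /PP'; apply: gspan_gen.
Qed.

Hypothesis X_cons : forall q w x, X w x -> X (wcat [:: q] w) (eta q.1 *_(q.2) x).

Lemma gen_lprod p w x : X w x -> X (wcat p w) (lprod p x).
Proof.
elim: p => [|q p IH] Xx; first by rewrite wcat0.
by rewrite -(wcat_wcat [:: q]); apply: X_cons; apply: IH.
Qed.

Lemma gspan_lprod p P P' : (forall z, P z -> P' (wcat p z)) ->
  forall x, gspan P x -> gspan P' (lprod p x).
Proof.
move=> PP'; apply: gspan_linear => // [|w x /(gen_lprod p) Xx /PP'].
- exact: lprod_linear.
- exact: gspan_gen.
Qed.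

Lemma gspan_cons q P P' : (forall z, P z -> P' (wcat [:: q] z)) ->
  forall x, gspan P x -> gspan P' (eta q.1 *_(q.2) x).
Proof. exact: (@gspan_lprod [:: q]). Qed.

(** This brings an arbitrary index [M] below [N]: b_(M) (a_(n) x) is a combination of products
    (b_(i) a)_(j) x, which vanish for i >= N by locality; for i < N, reassociating to the right only
    lowers [i]. *)
Lemma gspan_letter_cons b a l x n :
  (forall M, gspan (head_le (wletter a) l) (eta a *_(M) x)) ->
  forall M, gspan (head_le (wletter b) l.+1) (eta b *_(M) (eta a *_(n) x)).
Proof.
move=> H M; apply: cprodA_sub_rev => // i j _.
have [Ni|iN] := leqP N i; first by rewrite eta_loc // cprod0l; apply: gspan0.
apply: cprodA_sub => // i' j' le.
have i'N : (i' < N)%N by apply: leq_ltn_trans le iN.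
apply: (@gspan_cons (b, Ordinal i'N) (head_le (wletter a) l)) => // z.
exact: head_le_letterS.
Qed.

Lemma gspan_assoc_cons q y x w l m :
  (forall j, gspan (head_le w l) (y *_(j) x)) ->
  gspan (head_le (wcat [:: q] w) l) ((eta q.1 *_(q.2) y) *_(m) x).
Proof.
move=> H; case: q => b n; apply: cprodA_sub => // i j le.
have iN : (i < N)%N by apply: leq_ltn_trans le (ltn_ord n).
by apply: (@gspan_cons (b, Ordinal iN) _ _ _ _ (H j)) => z; apply: head_le_cons_le.
Qed.

(** The correction terms start with the same letter and a strictly smaller index, so they lie below
    every word of the right length starting with [q]; only the length of [z] matters. *)
Lemma gspan_assoc_cons_top q y x w l m z :
  (forall j, gspan (head_le w l) (y *_(j) x)) -> wlen z = (wlen w + l)%N ->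
  gspan (fun z' => wlt z' (wcat [:: q] z))
    ((eta q.1 *_(q.2) y) *_(m) x - eta q.1 *_(q.2) (y *_(m) x)).
Proof.
move=> H Ez; case: q => b n; apply: cprodA_top => // i j lt.
have iN : (i < N)%N by apply: ltn_trans lt (ltn_ord n).
apply: (@gspan_cons (b, Ordinal iN) _ _ _ _ (H j)) => z' [m' [r [Er /wle_wlen le]]].
apply: wlt_index => //; apply: leq_trans le _.
by rewrite wlen_wcat size_prefix_of Er Ez.
Qed.

(** Moving D past a letter, D(b_(n) y) = b_(n) Dy - n b_(n-1) y, leaves an extra term with a smaller
    index. *)
Lemma deriv_lprod p w x : X w x ->
  gspan (fun z => wlt z (wcat p (wD w 1))) (cderiv (lprod p x) - lprod p (cderiv x)).
Proof.
move=> Xx; elim: p => [|[b n] p IH] /=; first by rewrite subrr; apply: gspan0.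
rewrite cderiv_prod cprod_derivl -addrA; apply: gspanD.
  apply: gspanN; case: n => -[|n] ltn /=.
    by rewrite scale0r; apply: gspan0.
  apply: gspanZ.
  apply: (@gspan_gen _ (wcat [:: (b, Ordinal (ltnW ltn))] (wcat p w))).
    by apply: X_cons; apply: gen_lprod.
  rewrite -(wcat_wcat [:: (b, Ordinal ltn)] p).
  by apply: wlt_index; rewrite // !wlen_wcat.
rewrite -linearB; apply: (@gspan_cons (b, n) _ _ _ _ IH) => z lt.
by rewrite -(wcat_wcat [:: (b, n)] p); apply/wlt_wcat.
Qed.

Section LeftClosed.
Hypothesis X_left : forall b M w x, X w x ->
  gspan (head_le (wletter b) (wlen w)) (eta b *_(M) x).

Lemma nword_gen_head u m w x : X w x -> gspan (head_le u (wlen w)) (nword u *_(m) x).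
Proof.
move=> Xx; case: u => -[p b] i; rewrite /nword /wprefix /wlast /wind /=.
elim: p m => [|[a n] p IH] m /=.
  have [s [M ->]] := cprod_iter_derivl i m (eta b) x.
  by apply: gspanZ; apply: X_left.
exact: (gspan_assoc_cons (a, n) _ IH).
Qed.

Lemma nword_gen_top u (m : 'I_N) w x : X w x -> wDfree u ->
  gspan (fun z => wlt z (wcat (prefix_of u m) w))
    (nword u *_(m) x - lprod (prefix_of u m) x).
Proof.
move=> Xx; case: u => -[p b] i; rewrite /wDfree /nword /prefix_of /wprefix /wlast /wind /=.
move=> -> /=; elim: p => [|[a n] p IH] /=; first by rewrite subrr; apply: gspan0.
rewrite -[X in gspan _ (X - _)](subrK (eta a *_(n) (lprod p (eta b) *_(m) x))) -addrA.
apply: gspanD.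
  apply: (@gspan_assoc_cons_top (a, n) _ x (p, b, 0%N) (wlen w) m (wcat (rcons p (b, m)) w)).
    by move=> j; apply: (@nword_gen_head (p, b, 0%N)).
  by rewrite wlen_wcat size_rcons.
rewrite -linearB; apply: (@gspan_cons (a, n) _ _ _ _ IH) => z lt.
exact/(wlt_wcat [:: (a, n)] z (wcat (rcons p (b, m)) w)).
Qed.

End LeftClosed.
End Generators.
End WordSpans.

(** * Normal words form a basis *)

Section NormalWords.
Context {k : fieldType} {d : Order.disp_t} {B : orderType d} {N : nat}.
Context {C : assocConformalType k} (eta : B -> C).
Hypothesis eta_loc : has_locality N eta.
Implicit Types (u v w z r c : word B N) (p : seq (B * 'I_N)).
Implicit Types (x y f g : C) (P : set (word B N)).

Definition is_nword (w : word B N) : set C := fun x => x = nword eta w.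

Lemma is_nword_cons (q : B * 'I_N) w x :
  is_nword w x -> is_nword (wcat [:: q] w) (eta q.1 *_(q.2) x).
Proof. by move=> ->. Qed.

Lemma deriv_nword u : gspan is_nword (fun z => wlt z (wD u 1))
  (cderiv (nword eta u) - nword eta (wD u 1)).
Proof.
case: u => -[p b] i.
have := @deriv_lprod _ _ _ _ _ eta is_nword is_nword_cons p ([::], b, i) _ erefl.
by rewrite /nword /wD /wcat /wprefix /wlast /wind /= cats0 addn1.
Qed.

Lemma gspan_nword_deriv P : (forall z z', wle z z' -> P z' -> P z) ->
  (forall z, P z -> P (wD z 1)) ->
  forall x, gspan is_nword P x -> gspan is_nword P (cderiv x).
Proof.
move=> Pdown PD; apply: gspan_linear => [||w _ -> Pw].
- exact: cderiv_linear.
- exact: gspan_subspace.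
rewrite -[cderiv _](subrK (nword eta (wD w 1))); apply: gspanD.
  by apply: (gspan_sub _ (deriv_nword w)) => z /wltW le; apply: Pdown le _; apply: PD.
by apply: gspan_gen (PD _ Pw).
Qed.

Lemma nword_left b M w x : is_nword w x ->
  gspan is_nword (head_le (wletter b) (wlen w)) (eta b *_(M) x).
Proof.
move=> ->; case: w => -[p a] i; elim: p b M => [|[a' n] p IH] b M.
  elim: i M => [|i IH] M.
    have [NM|MN] := leqP N M; first by rewrite eta_loc //; apply: gspan0.
    apply: (@gspan_gen _ _ _ _ _ is_nword _ (wcat [:: (b, Ordinal MN)] (wletter a))) => //.
    exact: (head_le_letter (b, Ordinal MN)).
  rewrite /nword /= cprod_derivr; apply: gspanD; last by apply: gspanZ; apply: IH.
  apply: gspan_nword_deriv (IH M) => [z z'|z]; first exact: head_le_down.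
  exact: head_le_wD.
exact: (@gspan_letter_cons _ _ _ _ _ eta eta_loc is_nword is_nword_cons b a' _ (nword eta (p, a, i)) n (IH a')).
Qed.

Lemma nword_nword_head u m w :
  gspan is_nword (head_le u (wlen w)) (nword eta u *_(m) nword eta w).
Proof. exact: (nword_gen_head is_nword_cons nword_left). Qed.

Lemma nword_nword_top u (m : 'I_N) w : wDfree u ->
  gspan is_nword (fun z => wlt z (wcat (prefix_of u m) w))
    (nword eta u *_(m) nword eta w - nword eta (wcat (prefix_of u m) w)).
Proof. by rewrite nword_wcat; apply: (nword_gen_top is_nword_cons nword_left). Qed.

Lemma gspan_nword_prod n x y : gspan is_nword setT x -> gspan is_nword setT y ->
  gspan is_nword setT (x *_(n) y).
Proof.
move=> + Hy; move: x; apply: (gspan_linear (F := fun x => x *_(n) y)) => [||u _ -> _].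
- exact: cprod_linear_l.
- exact: gspan_subspace.
move: y Hy; apply: gspan_linear => [||v _ -> _].
- exact: cprod_linear_r.
- exact: gspan_subspace.
by apply: (gspan_sub _ (nword_nword_head u n v)).
Qed.

End NormalWords.

(** * The free algebra is generated by the letters *)

Section Subalgebra.
Context {k : fieldType} {C : assocConformalType k} (U : set C).
Hypothesis subU : subspace U.
Hypothesis U_deriv : forall x, U x -> U (cderiv x).
Hypothesis U_prod : forall n x y, U x -> U y -> U (x *_(n) y).

Definition in_sub : {pred C} := fun x => `[< U x >].

Lemma in_subP x : reflect (U x) (x \in in_sub).
Proof. exact: asboolP. Qed.

Fact in_sub_submod_closed : submod_closed in_sub.
Proof.
split=> [|a x y /in_subP Ux /in_subP Uy]; apply/in_subP; first exact: subspace0.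
exact: subU.2.
Qed.

HB.instance Definition _ := GRing.isSubmodClosed.Build k C in_sub in_sub_submod_closed.

Record subalg := Subalg { subalg_val : C; _ : subalg_val \in in_sub }.
HB.instance Definition _ := [isSub for subalg_val].
HB.instance Definition _ := [Choice of subalg by <:].
HB.instance Definition _ := [SubChoice_isSubLmodule of subalg by <:].

Lemma subalg_valP (x : subalg) : U (val x).
Proof. by case: x => x /= /in_subP. Qed.

Definition mk_subalg x (Ux : U x) : subalg := Subalg (introT (in_subP x) Ux).

Definition sub_deriv (x : subalg) := mk_subalg (U_deriv (subalg_valP x)).
Definition sub_prod n (x y : subalg) :=
  mk_subalg (U_prod n (subalg_valP x) (subalg_valP y)).

Lemma sub_deriv_linear : linear sub_deriv.
Proof. by move=> a x y; apply: val_inj; rewrite /= !linearP. Qed.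

Lemma sub_prod_linear_l n y : linear (sub_prod n ^~ y).
Proof. by move=> a x x'; apply: val_inj; rewrite /= cprodPl. Qed.

Lemma sub_prod_linear_r n x : linear (sub_prod n x).
Proof. by move=> a y y'; apply: val_inj; rewrite /= !linearP. Qed.

Lemma sub_prod_locality x y : exists M, forall n, (M <= n)%N -> sub_prod n x y = 0.
Proof.
have [M HM] := cprod_locality (val x) (val y).
by exists M => n /HM E; apply: val_inj.
Qed.

Lemma sub_deriv_prod n x y :
  sub_deriv (sub_prod n x y) = sub_prod n (sub_deriv x) y + sub_prod n x (sub_deriv y).
Proof. by apply: val_inj; rewrite /= cderiv_prod. Qed.

Lemma sub_prodS_deriv n x y : sub_prod n.+1 (sub_deriv x) y = - (n.+1%:R *: sub_prod n x y).
Proof. by apply: val_inj; rewrite /= cprodS_deriv_l. Qed.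

Lemma sub_prod0_deriv x y : sub_prod 0 (sub_deriv x) y = 0.
Proof. by apply: val_inj; rewrite /= cprod0_deriv_l. Qed.

Lemma sub_prodA n m x y z : sub_prod m (sub_prod n x y) z =
  \sum_(t < n.+1) ((-1) ^+ t * 'C(n, t)%:R) *: sub_prod (n - t) x (sub_prod (m + t) y z).
Proof. by apply: val_inj; rewrite [RHS](raddf_sum val) /= cprodA. Qed.

Definition subalg_conformal : conformalType k := HB.pack subalg
  (@isConformal.Build k subalg sub_deriv sub_prod sub_deriv_linear sub_prod_linear_l
     sub_prod_linear_r sub_prod_locality sub_deriv_prod sub_prodS_deriv sub_prod0_deriv).

Definition subalg_assoc : assocConformalType k := HB.pack
  (Conformal.sort subalg_conformal)
  (@Conformal_isAssoc.Build k subalg_conformal sub_prodA).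

(* The inclusion after the map to the subalgebra extends [eta], hence is the identity. *)
Lemma free_generated (B : Type) N (eta : B -> C) : is_free_assoc_conformal N eta ->
  (forall b, U (eta b)) -> forall x, U x.
Proof.
move=> [eta_loc free] Ueta x.
pose eps b : subalg_assoc := mk_subalg (Ueta b).
have eps_loc : has_locality N eps.
  by move=> a b n Nn; apply: val_inj; rewrite /= eta_loc.
have [phi [[[phiP phiD phiM] phi_eta] _]] := free _ _ eps_loc.
have [psi [_ uniq]] := free _ _ eta_loc.
have -> : x = val (phi x); last exact: subalg_valP.
transitivity (psi x); first by rewrite (uniq id).
rewrite (uniq (fun x => val (phi x))) //; split=> [|b]; last by rewrite phi_eta.
split=> [a y z|y|n y z].
- by rewrite phiP.
- by rewrite phiD.
- by rewrite phiM.
Qed.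

End Subalgebra.

(** * Spanning and linear independence *)

Section Basis.
Context {k : fieldType} {d : Order.disp_t} {B : orderType d} {N : nat}.
Context {C : assocConformalType k} (eta : B -> C).
Hypothesis C_free : is_free_assoc_conformal N eta.
Implicit Types (u v w : word B N) (f x : C) (g : malg (word B N) k) (P : set (word B N)).

Lemma nword_span x : gspan (is_nword (N := N) eta) setT x.
Proof.
have eta_loc := C_free.1.
apply: (free_generated _ _ _ C_free) => [|y|n y z|b].
- exact: gspan_subspace.
- by apply: gspan_nword_deriv.
- exact: gspan_nword_prod.
- exact: (@gspan_gen _ _ _ _ _ _ _ (wletter b)).
Qed.

Definition comb (g : malg (word B N) k) : C := mlift (nword eta) g.

Lemma comb_linear : linear comb.
Proof. exact: mlift_linear. Qed.

HB.instance Definition _ := GRing.isLinear.Build k (malg (word B N) k) C *:%R comb comb_linear.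

Lemma comb_base u : comb (mbase u) = nword eta u.
Proof. exact: mlift_base. Qed.

Lemma comb_surj x : exists g, comb g = x.
Proof.
move: x (nword_span x) => x; elim=> [|a {}x y [w -> _] _ [g <-]]; first by exists 0; rewrite linear0.
by exists (a *: mbase w + g); rewrite comb_linear comb_base.
Qed.

Lemma exists_max (s : seq (word B N)) : s != [::] ->
  exists2 u, u \in s & forall v, v \in s -> wle v u.
Proof.
elim: s => // u [|u' s] IH _.
  by exists u; rewrite ?mem_head // => v; rewrite inE => /eqP ->; apply: wle_refl.
have [//|v vs vmax] := IH; have [E|uv|vu] := wlt_total u v.
- exists v; first by rewrite inE vs orbT.
  by move=> z; rewrite inE => /orP[/eqP ->|/vmax //]; rewrite E; apply: wle_refl.
- exists v; first by rewrite inE vs orbT.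
  by move=> z; rewrite inE => /orP[/eqP ->|/vmax //]; apply: wltW.
- exists u; first exact: mem_head.
  move=> z; rewrite inE => /orP[/eqP ->|/vmax le]; first exact: wle_refl.
  by apply: wle_trans le _; apply: wltW.
Qed.

(** The functional of the largest word of a relation, pulled back from the model, kills all other
    terms and returns the coefficient of that word. *)
Lemma comb_inj : injective comb.
Proof.
have [A [eps [tau [eps_loc tauP tau1 tau0]]]] := exists_dual_model k B N.
have [phi [[[phiP phiD phiM] phi_eta] _]] := C_free.2 _ _ eps_loc.
have phi_nword u : phi (nword eta u) = nword eps u.
  case: u => -[p b] i; rewrite /nword /wprefix /wlast /wind /=.
  elim: p => [|q p IH] /=; last by rewrite phiM IH phi_eta.
  by elim: i => [|i IH] //=; rewrite phiD IH.
suff ker0 g : comb g = 0 -> g = 0.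
  move=> g g' E; apply/eqP; rewrite -subr_eq0; apply/eqP/ker0.
  by rewrite linearB /= E subrr.
move=> g0; have [E|nz] := eqVneq (finmap.enum_fset (msupp g)) [::].
  by rewrite (monalgE g) E big_nil.
have [u us umax] := exists_max nz.
pose T (x : C) : k := tau u (phi x).
have TP : scalar T by move=> a x y; rewrite /T phiP tauP.
have T0 : T 0 = 0 by move: (TP (-1) 0 0); rewrite scaler0 addr0 mulN1r addNr.
have sumE (s : seq (word B N)) : uniq s -> (forall v, v \in s -> wle v u) ->
    T (\sum_(v <- s) mcoeff v g *: nword eta v) = if u \in s then mcoeff u g else 0.
  elim: s => [|v s IH] /=; first by rewrite big_nil.
  case/andP => vs us' smax; rewrite big_cons TP IH //; last first.
    by move=> z zs; apply: smax; rewrite inE zs orbT.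
  rewrite /T phi_nword inE; case: eqVneq => [E|ne] /=.
    by rewrite E tau1 mulr1 (negPf vs) addr0.
  rewrite tau0 ?mulr0 ?add0r //.
  by have /wleE[E|//] := smax v (mem_head _ _); rewrite E eqxx in ne.
have := sumE _ (finmap.fset_uniq (msupp g)) umax; rewrite us.
rewrite -[\sum_(v <- _) _]/(comb g) g0 T0 => E.
by have := us; rewrite -[_ \in _]mcoeff_neq0 -E eqxx.
Qed.
End Basis.

(** Coefficient functionals replace the model: the leading-word arguments below use the basis only
    through these three properties. *)
Lemma exists_coef (k : fieldType) (d : Order.disp_t) (B : orderType d) (N : nat)
    (C : assocConformalType k) (eta : B -> C) : is_free_assoc_conformal N eta ->
  exists coef : word B N -> C -> k,
    [/\ forall u, scalar (coef u),
        forall u v, coef u (nword eta v) = (v == u)%:R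
      & forall f, exists s, [/\ uniq s, forall u, (u \in s) = (coef u f != 0)
                              & f = \sum_(u <- s) coef u f *: nword eta u]].
Proof.
move=> C_free; pose inv f := sval (cid (comb_surj C_free f)).
have invK f : comb eta (inv f) = f by rewrite /inv; case: (cid _).
exists (fun u f => mcoeff u (inv f)); split=> [u a x y|u v|f].
- have -> : inv (a *: x + y) = a *: inv x + inv y.
    by apply: (comb_inj C_free); rewrite comb_linear !invK.
  by rewrite mcoeffD mcoeffZ.
- have -> : inv (nword eta v) = mbase v.
    by apply: (comb_inj C_free); rewrite comb_base invK.
  by rewrite mcoeffU.
- exists (finmap.enum_fset (msupp (inv f))).
  split=> [|u|]; [exact: finmap.fset_uniq | by rewrite mcoeff_neq0 | by rewrite -[LHS]invK].
Qed.

(** * Coefficients, supports and leading terms *)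

Section Leading.
Context {k : fieldType} {d : Order.disp_t} {B : orderType d} {N : nat}.
Context {C : assocConformalType k} {eta : B -> C}.
Variable coef : word B N -> C -> k.
Hypothesis coef_linear : forall u, scalar (coef u).
Hypothesis coef_nword : forall u v, coef u (nword eta v) = (v == u)%:R.
Hypothesis coef_expand : forall f, exists s,
  [/\ uniq s, forall u, (u \in s) = (coef u f != 0)
    & f = \sum_(u <- s) coef u f *: nword eta u].
Implicit Types (u v w : word B N) (f g x : C) (P : set (word B N)).

HB.instance Definition _ u := GRing.isLinear.Build k C k *%R (coef u) (coef_linear u).

Lemma coefD u x y : coef u (x + y) = coef u x + coef u y.
Proof. exact: linearD. Qed.

Lemma coefZ u a x : coef u (a *: x) = a * coef u x.
Proof. exact: linearZ. Qed.

Lemma coefB u x y : coef u (x - y) = coef u x - coef u y.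
Proof. exact: linearB. Qed.

Local Notation W := (gspan (is_nword (N := N) eta)).

Lemma gspan_nword P u : P u -> W P (nword eta u).
Proof. by move=> Pu; apply: (@gspan_gen _ _ _ _ _ _ _ u). Qed.

Lemma gspan_nwordP P f : W P f <-> forall u, coef u f != 0 -> P u.
Proof.
split=> [|H].
  elim=> [u|a x y [w -> Pw] _ IH u]; first by rewrite linear0 eqxx.
  rewrite linearP /= coef_nword; case: (w =P u) => [<- //|_].
  by rewrite mulr0 add0r; apply: IH.
have [s [_ Es ->]] := coef_expand f.
apply: subspace_sum => [|u]; first exact: gspan_subspace.
by rewrite Es => /H Pu; apply: gspanZ; apply: gspan_nword Pu.
Qed.

Lemma coef_sum (e : seq (k * word B N)) u :
  coef u (\sum_(q <- e) q.1 *: nword eta q.2) =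
  \sum_(q <- e) (if q.2 == u then q.1 else 0).
Proof.
rewrite linear_sum /=; apply: eq_bigr => q _.
by rewrite linearZ /= coef_nword; case: eqP; rewrite ?mulr1 ?mulr0.
Qed.

Lemma expansion_coef f (e : seq (k * word B N)) : expansion eta f e ->
  (forall q, q \in e -> q.1 = coef q.2 f) /\
  (forall u, coef u f != 0 -> (coef u f, u) \in e).
Proof.
move=> [ue nz ->]; have Hq q : q \in e ->
    coef q.2 (\sum_(q <- e) q.1 *: nword eta q.2) = q.1.
  rewrite coef_sum; elim: e ue {nz} => //= a e IH /andP[ae ue]; rewrite inE big_cons.
  case/orP => [/eqP ->|qe]; last first.
    rewrite (IH ue qe); case: eqP => [E|]; last by rewrite add0r.
    by rewrite E map_f in ae.
  rewrite eqxx big1_seq ?addr0 // => q' /= q'e.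
  by case: eqP => // E; rewrite -E map_f in ae.
split=> [q /Hq //|u nzu]; have : u \in [seq q.2 | q <- e].
  apply: contraNT nzu => uNe; rewrite coef_sum big1_seq // => q /= qe.
  by case: eqP => // E; rewrite -E map_f in uNe.
by case/mapP => q qe Eu; rewrite Eu Hq // -surjective_pairing.
Qed.

Lemma exists_expansion f : exists e : seq (k * word B N), expansion eta f e.
Proof.
have [s [us Es Ef]] := coef_expand f.
exists [seq (coef u f, u) | u <- s]; split.
- by rewrite -map_comp map_id.
- by move=> q /mapP[u us' ->] /=; rewrite -Es.
- by rewrite big_map.
Qed.

Lemma suppP f u : supp eta f u <-> coef u f != 0.
Proof.
split=> [[e He /mapP[q qe ->]]|nz].
  by have [H _] := expansion_coef He; rewrite -H //; case: He => _ nz _; apply: nz.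
have [e He] := exists_expansion f; exists e => //.
by have [_ H] := expansion_coef He; apply/mapP; exists (coef u f, u); rewrite ?H.
Qed.

Lemma lead_termP f a u :
  lead_term eta f a u <-> [/\ a != 0, coef u f = a & W (wle ^~ u) f].
Proof.
split=> [[e [He ae emax]]|[nz Ea /gspan_nwordP H]].
  have [H1 H2] := expansion_coef He; split.
  - by case: He => _ nz _; apply: (nz _ ae).
  - by rewrite -(H1 _ ae).
  - by apply/gspan_nwordP => v /H2 /emax.
have [e He] := exists_expansion f; have [H1 H2] := expansion_coef He.
exists e; split=> //; first by rewrite -Ea; apply: H2; rewrite Ea.
by move=> q qe; apply: H; rewrite -H1 //; case: He => _ nzq _; apply: nzq.
Qed.

Lemma leadP f u : lead eta f u <-> coef u f != 0 /\ W (wle ^~ u) f.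
Proof.
split=> [[a /lead_termP[nz -> H]] //|[nz H]].
by exists (coef u f); apply/lead_termP.
Qed.

Lemma lead_uniq f u v : lead eta f u -> lead eta f v -> u = v.
Proof.
case/leadP => nzu /gspan_nwordP Hu /leadP[nzv /gspan_nwordP Hv].
by apply: wle_anti; [apply: Hv | apply: Hu].
Qed.

Lemma exists_lead f : f <> 0 -> exists u, lead eta f u.
Proof.
move=> nz; have [s [_ Es Ef]] := coef_expand f.
have [u us umax] : exists2 u, u \in s & forall v, v \in s -> wle v u.
  by apply: exists_max; apply: contra_notN nz => /eqP s0; rewrite Ef s0 big_nil.
exists u; apply/leadP; rewrite -Es; split=> //.
by apply/gspan_nwordP => v; rewrite -Es; apply: umax.
Qed.

Lemma gspan_le_lt f u : W (wle ^~ u) f -> coef u f = 0 -> W (wlt ^~ u) f.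
Proof.
move=> /gspan_nwordP H z; apply/gspan_nwordP => v nz.
by have /wleE[E|//] := H v nz; rewrite E z eqxx in nz.
Qed.

Lemma gspan_lt_coef f u : W (wlt ^~ u) f -> coef u f = 0.
Proof.
move=> /gspan_nwordP H; apply/eqP; apply: contra_notT (@wlt_irr _ _ _ u).
exact: H.
Qed.

Lemma lead_term1P f u : lead_term eta f 1 u <-> W (wlt ^~ u) (f - nword eta u).
Proof.
have cu : coef u (nword eta u) = 1 by rewrite coef_nword eqxx.
split=> [/lead_termP[_ Eu H]|H].
  apply: gspan_le_lt; last by rewrite linearB /= Eu cu subrr.
  by apply: gspanB => //; apply: gspan_nword; apply: wle_refl.
apply/lead_termP; split; first exact: oner_neq0.
  by have := gspan_lt_coef H; rewrite linearB /= cu => /eqP; rewrite subr_eq0 => /eqP.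
rewrite -[f](subrK (nword eta u)); apply: gspanD; last by apply: gspan_nword; apply: wle_refl.
by apply: (gspan_sub _ H) => v; apply: wltW.
Qed.

Lemma monic_lead f u : Defs.monic (N := N) eta f -> lead eta f u -> lead_term eta f 1 u.
Proof. by case=> v Hv Hu; rewrite (lead_uniq Hu (ex_intro (fun a => lead_term eta f a v) 1 Hv)). Qed.

Lemma Dfree_gspan f : Dfree (N := N) eta f -> W wDfree f.
Proof. by move=> H; apply/gspan_nwordP => u /suppP; apply: H. Qed.

Lemma gspan_bar_le f g u : bar_le (N := N) eta f g -> lead eta f u ->
  forall P, (forall z z', wle z z' -> P z' -> P z) -> W P g -> P u.
Proof.
move=> le /le[v /leadP[nz _] uv] P Pdown /gspan_nwordP HP.
exact: Pdown uv (HP _ nz).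
Qed.


(** * Normal S-words *)

Hypothesis eta_loc : has_locality N eta.
Implicit Types (c z : word B N).

Local Notation lead1 f u := (lead_term eta f 1 u).

Lemma lead1_lprod p f u : lead1 f u -> lead1 (lprod eta p f) (wcat p u).
Proof.
rewrite !lead_term1P nword_wcat -linearB => H.
by apply: (gspan_lprod (is_nword_cons (eta := eta)) _ H) => z lt; apply/wlt_wcat.
Qed.

Lemma gspan_nword_deriv_lt u f :
  W (wlt ^~ u) f -> W (wlt ^~ (wD u 1)) (cderiv f).
Proof.
apply: gspan_linear => [||w _ -> lt]; first exact: cderiv_linear.
  exact: gspan_subspace.
have lt' : wlt (wD w 1) (wD u 1) by apply/wlt_wD.
rewrite -[cderiv _](subrK (nword eta (wD w 1))); apply: gspanD; last exact: gspan_nword.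
by apply: (gspan_sub _ (deriv_nword eta w)) => z /wlt_trans; apply.
Qed.

Lemma lead1_deriv f u : lead1 f u -> lead1 (cderiv f) (wD u 1).
Proof.
rewrite !lead_term1P => /gspan_nword_deriv_lt H.
rewrite -[cderiv f](subrK (cderiv (nword eta u))) -linearB -addrA.
by apply: gspanD => //; apply: deriv_nword.
Qed.

Lemma lead1_iter_deriv i f u : lead1 f u -> lead1 (iter i cderiv f) (wD u i).
Proof.
move=> H; elim: i => [|i IH]; first by rewrite wD0.
by rewrite iterS -addn1 -wD_wD; apply: lead1_deriv.
Qed.

(** D-freeness of [u] ensures that the lower words of [f] stay strictly lower after the product with
    [c], by [head_le_lt]. *)
Lemma lead1_right f u (m : 'I_N) c : lead1 f u -> wDfree u ->
  lead1 (f *_(m) nword eta c) (wcat (prefix_of u m) c).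
Proof.
rewrite !lead_term1P => H uD.
rewrite -[f](subrK (nword eta u)) cprodDl -addrA; apply: gspanD; last exact: nword_nword_top.
move: H; apply: (gspan_linear (F := fun x => x *_(m) nword eta c)) => [||v _ -> lt].
- exact: cprod_linear_l.
- exact: gspan_subspace.
- apply: (gspan_sub _ (nword_nword_head eta_loc v m c)) => z; exact: head_le_lt.
Qed.

Section SWords.
Variable S : set C.
Hypothesis S_monic : S `<=` Defs.monic (N := N) eta.

Lemma S_lead f : S f -> exists u, lead eta f u.
Proof. by move=> /S_monic[u Hu]; exists u, 1. Qed.

Lemma S_lead1 f u : S f -> lead eta f u -> lead1 f u.
Proof. by move=> /S_monic; apply: monic_lead. Qed.

(** Normal S-words indexed by the word that turns out to be their leading word ([Sword_lead1]),
    which makes them generators for [gspan]. *)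
Inductive Sword : word B N -> C -> Prop :=
| Sword1 p s u (m : 'I_N) c of S s & lead eta s u & wDfree u :
    Sword (wcat p (wcat (prefix_of u m) c)) (lprod eta p (s *_(m) nword eta c))
| Sword2 p i s u of S s & lead eta s u :
    Sword (wcat p (wD u i)) (lprod eta p (iter i cderiv s)).

Lemma normal_SwordP x : normal_Sword (N := N) eta S x <-> exists w, Sword w x.
Proof.
split=> [[p s u m c Ss su uD|p i s Ss]|[w [p s u m c Ss su uD|p i s u Ss su]]].
- by exists (wcat p (wcat (prefix_of u m) c)); apply: Sword1.
- by have [u su] := S_lead Ss; exists (wcat p (wD u i)); apply: Sword2.
- exact: normal_Sword1 Ss su uD.
- exact: normal_Sword2.
Qed.

Lemma Sword_lead1 w x : Sword w x -> lead1 x w.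
Proof.
case=> [p s u m c Ss su uD|p i s u Ss su]; apply: lead1_lprod.
- by apply: lead1_right uD; apply: S_lead1.
- by apply: lead1_iter_deriv; apply: S_lead1.
Qed.

Lemma Sword_wdivides w x :
  Sword w x -> exists s u, [/\ S s, lead eta s u & wdivides u w].
Proof.
case=> [p s u m c Ss su uD|p i s u Ss su]; exists s, u; split=> //.
- by right; split=> //; exists p, m, c.
- by left; exists p, i.
Qed.

Lemma exists_Sword s u w : S s -> lead eta s u -> wdivides u w -> exists x, Sword w x.
Proof.
move=> Ss su [[p [i ->]]|[uD [p [m [c ->]]]]].
- by exists (lprod eta p (iter i cderiv s)); apply: Sword2.
- by exists (lprod eta p (s *_(m) nword eta c)); apply: Sword1.
Qed.

Lemma Sword_ideal J w x : is_ideal J -> S `<=` J -> Sword w x -> J x.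
Proof.
move=> [_ _ JD JM] SJ Xx.
have Jlprod p y : J y -> J (lprod eta p y).
  by move=> Jy; elim: p => [//|q p IH]; apply: (JM _ _ _ IH).2.
case: Xx => [p s u m c /SJ Js _ _|p i s u /SJ Js _]; apply: Jlprod.
- exact: (JM _ _ _ Js).1.
- by elim: i => [//|i]; apply: JD.
Qed.

Lemma Sword_cons (q : B * 'I_N) w x :
  Sword w x -> Sword (wcat [:: q] w) (eta q.1 *_(q.2) x).
Proof.
case=> [p s u m c Ss su uD|p i s u Ss su]; rewrite wcat_wcat.
- exact: (@Sword1 (q :: p)).
- exact: (@Sword2 (q :: p)).
Qed.

Local Notation V := (gspan Sword).

Lemma lead_gspan_le f u : lead eta f u -> W (wle ^~ u) f.
Proof. by case/leadP. Qed.

Lemma gspan_right p f u (m : 'I_N) P P' x : S f -> lead eta f u -> wDfree u ->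
  (forall z, P z -> P' (wcat p (wcat (prefix_of u m) z))) ->
  W P x -> V P' (lprod eta p (f *_(m) x)).
Proof.
move=> Sf fu uD PP'; apply: (gspan_linear (F := fun x => lprod eta p (f *_(m) x))).
- by move=> a y z; rewrite !linearP.
- exact: gspan_subspace.
- move=> w _ -> Pw; apply: (gspan_gen (w := wcat p (wcat (prefix_of u m) w))).
    exact: Sword1.
  exact: PP'.
Qed.

Lemma deriv_right f u (m : 'I_N) c : S f -> lead eta f u -> wDfree u ->
  V (fun z => wlt z (wcat (prefix_of u m) (wD c 1)))
    (cderiv (f *_(m) nword eta c) - f *_(m) nword eta (wD c 1)).
Proof.
move=> Sf fu uD; rewrite cderiv_prod cprod_derivl -addrA -linearB /=.
apply: gspanD.
  apply: gspanN; case: m => -[|m] lt /=; first by rewrite scale0r; apply: gspan0.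
  apply: gspanZ; apply: (gspan_gen (Sword1 [::] (Ordinal (ltnW lt)) c Sf fu uD)).
  by rewrite wcat0; apply: wlt_prefix_index.
apply: (@gspan_right [::] _ _ _ _ _ _ Sf fu uD _ (deriv_nword eta c)) => z lt.
by rewrite wcat0; apply/wlt_wcat.
Qed.

Lemma deriv_Sword1 p f u (m : 'I_N) c : S f -> lead eta f u -> wDfree u ->
  V (wlt ^~ (wcat p (wcat (prefix_of u m) (wD c 1))))
    (cderiv (lprod eta p (f *_(m) nword eta c)) - lprod eta p (f *_(m) nword eta (wD c 1))).
Proof.
move=> Sf fu uD; have /(deriv_lprod Sword_cons p) H := Sword1 [::] m c Sf fu uD.
rewrite -[cderiv _](subrK (lprod eta p (cderiv (f *_(m) nword eta c)))) -addrA.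
apply: gspanD; first by apply: (gspan_sub _ H) => z; rewrite wcat0 wcat_wD.
rewrite -linearB; apply: (gspan_lprod Sword_cons _ (deriv_right m c Sf fu uD)).
by move=> z lt; apply/wlt_wcat.
Qed.

Lemma deriv_Sword2 p f u i : S f -> lead eta f u ->
  V (wlt ^~ (wcat p (wD u i.+1)))
    (cderiv (lprod eta p (iter i cderiv f)) - lprod eta p (iter i.+1 cderiv f)).
Proof.
move=> Sf fu; have /(deriv_lprod Sword_cons p) H := Sword2 [::] i Sf fu.
by apply: (gspan_sub _ H) => z; rewrite wcat0 wD_wD addn1.
Qed.

Lemma deriv_Sword w x : Sword w x ->
  exists2 y, Sword (wD w 1) y & V (wlt ^~ (wD w 1)) (cderiv x - y).
Proof.
case=> [p f u m c Sf fu uD|p i f u Sf fu].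
  exists (lprod eta p (f *_(m) nword eta (wD c 1))); rewrite -!wcat_wD.
    exact: Sword1.
  exact: deriv_Sword1.
exists (lprod eta p (iter i.+1 cderiv f)); rewrite -wcat_wD wD_wD addn1.
  exact: Sword2.
exact: deriv_Sword2.
Qed.

Lemma gspan_deriv_lt w x : V (wlt ^~ w) x -> V (wlt ^~ (wD w 1)) (cderiv x).
Proof.
apply: gspan_linear => [||v y Xy lt]; first exact: cderiv_linear.
  exact: gspan_subspace.
have lt' : wlt (wD v 1) (wD w 1) by apply/wlt_wD.
have [z Xz H] := deriv_Sword Xy.
rewrite -[cderiv _](subrK z); apply: gspanD; last by apply: (gspan_gen Xz).
by apply: (gspan_sub _ H) => z' /wlt_trans; apply.
Qed.

Lemma gspan_iter_deriv_lt i w x : V (wlt ^~ w) x -> V (wlt ^~ (wD w i)) (iter i cderiv x).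
Proof.
move=> H; elim: i => [|i IH]; first by rewrite wD0.
by rewrite iterS -addn1 -wD_wD; apply: gspan_deriv_lt.
Qed.

Lemma gspan_deriv P : (forall z z', wle z z' -> P z' -> P z) ->
  (forall z, P z -> P (wD z 1)) -> forall x, V P x -> V P (cderiv x).
Proof.
move=> Pdown PD; apply: gspan_linear => [||w x Xx Pw]; first exact: cderiv_linear.
  exact: gspan_subspace.
have [y Xy H] := deriv_Sword Xx.
rewrite -[cderiv _](subrK y); apply: gspanD; last by apply: (gspan_gen Xy); apply: PD.
by apply: (gspan_sub _ H) => z /wltW le; apply: Pdown le _; apply: PD.
Qed.

(** * Consequences of the triviality of all compositions *)

Section Closed.
Hypothesis S_trivial : forall h, composition (N := N) eta S h -> trivial_mod (N := N) eta S h.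

(** Triviality bounds the normal S-words by the leading word of [h], hence by any downward closed
    set containing the words of [h]. *)
Lemma composition_gspan P h : composition (N := N) eta S h ->
  (forall z z', wle z z' -> P z' -> P z) -> W P h -> V P h.
Proof.
move=> /S_trivial[r [Hr Er]] Pdown WP; rewrite Er.
apply: subspace_sum => [|q qr]; first exact: gspan_subspace.
have [/normal_SwordP[w Xw] le] := Hr q qr.
apply: gspanZ; apply: (gspan_gen Xw); apply: gspan_bar_le le _ _ Pdown WP.
by exists 1; apply: Sword_lead1.
Qed.

(** D-free words inherit locality from the letters, because associativity only raises the index of
    the inner product. *)
Lemma nword_prod_letter0 u b n : wDfree u -> (N <= n)%N -> nword eta u *_(n) eta b = 0.
Proof.
case: u => -[p a] i; rewrite /wDfree /nword /wprefix /wlast /wind /= => -> /=.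
elim: p n => [|q p IH] n Nn /=; first exact: eta_loc.
rewrite cprodA big1 // => t _; rewrite IH ?linear0 ?scaler0 //.
exact: leq_trans Nn (leq_addr _ _).
Qed.

(** Of the four cases, two are right multiplication compositions: n < N with [u] not D-free, and n
    >= N with [f] not D-free. In the others the product is itself a normal S-word, or it
    vanishes. *)
Lemma right_letter f u n b : S f -> lead eta f u -> V (head_le u 1) (f *_(n) eta b).
Proof.
move=> Sf fu.
have WP : W (head_le u 1) (f *_(n) eta b).
  move: (lead_gspan_le fu).
  apply: (gspan_linear (F := fun x => x *_(n) eta b)) => [||v _ -> le].
  - exact: cprod_linear_l.
  - exact: gspan_subspace.
  - apply: (gspan_sub _ (nword_nword_head eta_loc v n (wletter b))) => z.
    exact: head_le_mono.
have Pdown z z' : wle z z' -> head_le u 1 z' -> head_le u 1 z by exact: head_le_down.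
have [Nn|nN] := leqP N n; last first.
  case: (pselect (wDfree u)) => uD; last first.
    by apply: composition_gspan => //; apply: comp_right_mult Sf fu _; left.
  apply: (gspan_gen (Sword1 [::] (Ordinal nN) (wletter b) Sf fu uD)).
  by rewrite wcat0; apply: (head_le_self u (wletter b)).
case: (pselect (Dfree (N := N) eta f)) => [fD|fD]; last first.
  by apply: composition_gspan => //; apply: comp_right_mult Sf fu _; right.
suff -> : f *_(n) eta b = 0 by apply: gspan0.
elim: (Dfree_gspan fD) => [|a x y [v -> vD] _ IH]; first exact: cprod0l.
by rewrite cprodPl IH nword_prod_letter0 // scaler0 addr0.
Qed.

Lemma gspan_right_lprod p w x l y : (forall n, V (head_le w l) (x *_(n) y)) ->
  forall n, V (head_le (wcat p w) l) (lprod eta p x *_(n) y).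
Proof.
move=> H; elim: p => [|q p IH] n; first by rewrite wcat0.
by rewrite -(wcat_wcat [:: q]); apply: (gspan_assoc_cons Sword_cons).
Qed.

(** Induction on [c]: f_(n) (b_(m) [c]) is a combination of products (f_(i) b)_(j) [c], where f_(i)
    b is a combination of normal S-words by [right_letter], to which the induction hypothesis
    applies. That is why the statement concerns all normal S-words and not only elements of [S]. *)
Lemma Sword_right c w x n : Sword w x -> V (head_le w (wlen c)) (x *_(n) nword eta c).
Proof.
(* Products of a normal S-word by [c'] reduce to products of elements of [S] by [c']. *)
have reduce (c' : word B N) : (forall f u n, S f -> lead eta f u ->
      V (head_le u (wlen c')) (f *_(n) nword eta c')) ->
    forall w x n, Sword w x -> V (head_le w (wlen c')) (x *_(n) nword eta c').
  move=> H {}w {}x n' [p f u m c1 Sf fu uD|p i f u Sf fu].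
    apply: gspan_right_lprod => j; apply: cprodA_sub; first exact: gspan_subspace.
    move=> i j' le; have iN : (i < N)%N by apply: leq_ltn_trans le (ltn_ord m).
    apply: (@gspan_right [::] _ _ (Ordinal iN) _ _ _ Sf fu uD _ (nword_nword_head eta_loc c1 j' c')).
    by move=> z zle; rewrite wcat0; apply: head_le_prefix.
  apply: gspan_right_lprod => j; have [s [m ->]] := cprod_iter_derivl i j f (nword eta c').
  by apply: gspanZ; exact: (H _ _ m Sf fu).
case: c => -[p b] i; elim: p w x n => [|[b' m] p IH]; apply: reduce => f u n Sf fu.
  elim: i n => [|i IH] n; first exact: right_letter.
  rewrite /nword /= cprod_derivr; apply: gspanD; last by apply: gspanZ; apply: IH.
  apply: gspan_deriv (IH n) => [z z'|z]; first exact: head_le_down.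
  exact: head_le_wD.
apply: cprodA_sub_rev => [|i' j _]; first exact: gspan_subspace.
move: (right_letter i' b' Sf fu).
apply: (gspan_linear (F := fun x => x *_(j) nword eta (p, b, i))) => [||w x Xx wle1].
- exact: cprod_linear_l.
- exact: gspan_subspace.
- by apply: (gspan_sub _ (IH w x j Xx)) => z /(head_le_trans wle1).
Qed.

Lemma gspan_Sword_right P P' c n x : V P x ->
  (forall w z, P w -> head_le w (wlen c) z -> P' z) -> V P' (x *_(n) nword eta c).
Proof.
move=> + PP'; move: x; apply: (gspan_linear (F := fun x => x *_(n) nword eta c)).
- exact: cprod_linear_l.
- exact: gspan_subspace.
- by move=> w x Xx Pw; apply: (gspan_sub _ (Sword_right c n Xx)) => z; apply: PP'.
Qed.

(** For an element of [S] an index M >= N gives a left multiplication composition. A normal S-word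
    f_(m) [c] is reassociated to (b_(j) f)_(j') [c], so closure on the right has to come first. *)
Lemma Sword_left b M w x : Sword w x ->
  V (head_le (wletter b) (wlen w)) (eta b *_(M) x).
Proof.
have letter_left b' f u M' : S f -> lead eta f u ->
    V (head_le (wletter b') (wlen u)) (eta b' *_(M') f).
  move=> Sf fu; have [NM|MN] := leqP N M'; last first.
    apply: (gspan_gen (Sword_cons (b', Ordinal MN) (Sword2 [::] 0 Sf fu))).
    by rewrite wcat0 wD0; apply: (head_le_letter (b', Ordinal MN)).
  apply: composition_gspan; first exact: comp_left_mult.
    by move=> z z'; apply: head_le_down.
  move: (lead_gspan_le fu); apply: gspan_linear => [||v y Xy /wle_wlen le].
  - exact: cprod_linear_r.
  - exact: gspan_subspace.
  - by apply: (gspan_sub _ (nword_left eta_loc b' M' Xy)) => z; apply: head_le_len.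
move=> Xw; suff cons_case p y v : Sword v y ->
    (forall b M, V (head_le (wletter b) (wlen v)) (eta b *_(M) y)) ->
    forall b M, V (head_le (wletter b) (wlen (wcat p v))) (eta b *_(M) lprod eta p y).
  case: Xw b M => {w x} [p f u m c Sf fu uD|p i f u Sf fu].
    apply: cons_case; first by rewrite -[wcat _ _]wcat0; apply: (@Sword1 [::]).
    move=> b M; apply: cprodA_sub_rev => [|j j' _]; first exact: gspan_subspace.
    apply: (gspan_Sword_right _ (letter_left b f u j Sf fu)) => w z.
    by rewrite wlen_wcat size_prefix_of; apply: head_le_trans.
  apply: cons_case; first by rewrite -[wD _ _]wcat0; apply: (@Sword2 [::]).
  elim: i => [|i IH] b M; first exact: (letter_left b f u M Sf fu).
  rewrite iterS cprod_derivr; apply: gspanD; last by apply: gspanZ; apply: IH.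
  apply: gspan_deriv (IH b M) => [z z'|z]; first exact: head_le_down.
  exact: head_le_wD.
move=> Xy Hy; elim: p => [|[a n] p IH] {}b {}M; first by rewrite wcat0.
exact: (@gspan_letter_cons _ _ _ _ _ eta eta_loc Sword Sword_cons b a
  (wlen (wcat p v)) (lprod eta p y) n (IH a)).
Qed.

Lemma right_lprod_top p w (m : 'I_N) c x : Sword w x ->
  V (wlt ^~ (wcat p (wcat (prefix_of w m) c)))
    (lprod eta p x *_(m) nword eta c - lprod eta p (x *_(m) nword eta c)).
Proof.
move=> Xx; elim: p => [|q p IH] /=; first by rewrite subrr; apply: gspan0.
set y := lprod eta p x *_(m) nword eta c in IH *.
rewrite -[X in V _ (X - _)](subrK (eta q.1 *_(q.2) y)) -addrA -linearB.
apply: gspanD.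
  apply: (@gspan_assoc_cons_top _ _ _ _ _ eta Sword Sword_cons q (lprod eta p x)
    (nword eta c) (wcat p w) (wlen c) m (wcat p (wcat (prefix_of w m) c))) => [j|]; last first.
    by rewrite !wlen_wcat size_prefix_of addnA.
  by apply: Sword_right; apply: (gen_lprod Sword_cons).
apply: (gspan_cons Sword_cons _ IH) => z lt.
exact/(wlt_wcat [:: q] z (wcat p (wcat (prefix_of w m) c))).
Qed.

Lemma right_right_top f u (n m : 'I_N) c1 c : S f -> lead eta f u -> wDfree u ->
  wDfree c1 ->
  V (wlt ^~ (wcat (prefix_of u n) (wcat (prefix_of c1 m) c)))
    ((f *_(n) nword eta c1) *_(m) nword eta c
     - f *_(n) nword eta (wcat (prefix_of c1 m) c)).
Proof.
move=> Sf fu uD c1D.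
rewrite -[X in V _ (X - _)](subrK (f *_(n) (nword eta c1 *_(m) nword eta c))) -addrA -linearB.
apply: gspanD.
  apply: cprodA_top => [|i j lt]; first exact: gspan_subspace.
  have iN : (i < N)%N by apply: ltn_trans lt (ltn_ord n).
  apply: (@gspan_right [::] _ _ (Ordinal iN) _ _ _ Sf fu uD _ (nword_nword_head eta_loc c1 j c)).
  move=> z [m' [r [Er /wle_wlen le]]]; rewrite wcat0; apply: wlt_prefix_index => //.
  by apply: leq_trans le _; rewrite !wlen_wcat !size_prefix_of Er.
apply: (@gspan_right [::] _ _ _ _ _ _ Sf fu uD _ (nword_nword_top eta_loc m c c1D)).
by move=> z lt; rewrite wcat0; apply/wlt_wcat.
Qed.

Lemma gspan_right_lt v (m : 'I_N) c x : wDfree v -> V (wlt ^~ v) x ->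
  V (wlt ^~ (wcat (prefix_of v m) c)) (x *_(m) nword eta c).
Proof.
move=> vD Vx; apply: (gspan_Sword_right _ Vx) => w z lt; exact: head_le_lt.
Qed.

(** * Two normal S-words with the same leading word *)

Definition eqv w x y := V (wlt ^~ w) (x - y).

Lemma eqv_refl w x : eqv w x x.
Proof. by rewrite /eqv subrr; apply: gspan0. Qed.

Lemma eqv_sym w x y : eqv w x y -> eqv w y x.
Proof. by rewrite /eqv => H; rewrite -opprB; apply: gspanN. Qed.

Lemma eqv_trans (y : C) w x (z : C) : eqv w x y -> eqv w y z -> eqv w x z.
Proof.
by rewrite /eqv => H1 H2; rewrite -[x](subrK y) -addrA; apply: gspanD.
Qed.

Lemma eqv_lprod p w x y : eqv w x y -> eqv (wcat p w) (lprod eta p x) (lprod eta p y).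
Proof.
rewrite /eqv -linearB; apply: (gspan_lprod Sword_cons) => z lt; exact/wlt_wcat.
Qed.

Lemma eqv_deriv i w x y :
  eqv w x y -> eqv (wD w i) (iter i cderiv x) (iter i cderiv y).
Proof. by rewrite /eqv -linearB; apply: gspan_iter_deriv_lt. Qed.

Lemma eqv_right w (m : 'I_N) c x y : wDfree w -> eqv w x y ->
  eqv (wcat (prefix_of w m) c) (x *_(m) nword eta c) (y *_(m) nword eta c).
Proof. by rewrite /eqv -cprodBl; apply: gspan_right_lt. Qed.

(** Both elements are monic with leading word [w], so their difference has only words below [w], and
    triviality respects that bound. *)
Lemma eqv_composition w x y : Sword w x -> Sword w y ->
  composition (N := N) eta S (x - y) -> eqv w x y.
Proof.
move=> /Sword_lead1/lead_term1P Hx /Sword_lead1/lead_term1P Hy Hc.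
apply: composition_gspan Hc _ _ => [z z'|]; first exact: wle_lt_trans.
rewrite -[x](subrK (nword eta w)) -addrA; apply: gspanD => //.
by rewrite -opprB; apply: gspanN.
Qed.

Lemma iter_deriv_lprod_right i p f u (m : 'I_N) c : S f -> lead eta f u -> wDfree u ->
  eqv (wcat p (wcat (prefix_of u m) (wD c i)))
    (iter i cderiv (lprod eta p (f *_(m) nword eta c)))
    (lprod eta p (f *_(m) nword eta (wD c i))).
Proof.
move=> Sf fu uD; elim: i => [|i IH]; first by rewrite wD0; apply: eqv_refl.
have := eqv_deriv 1 IH; rewrite -wcat_wD -wcat_wD wD_wD addn1 => H.
apply: eqv_trans H _; rewrite /= -addn1 -wD_wD.
exact: deriv_Sword1.
Qed.

Lemma iter_deriv_lprod i p f u j : S f -> lead eta f u ->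
  eqv (wcat p (wD u (j + i)))
    (iter i cderiv (lprod eta p (iter j cderiv f)))
    (lprod eta p (iter (j + i) cderiv f)).
Proof.
move=> Sf fu; elim: i => [|i IH]; first by rewrite addn0; apply: eqv_refl.
have := eqv_deriv 1 IH; rewrite -wcat_wD wD_wD addn1 -addnS => H.
apply: eqv_trans H _; rewrite addnS; exact: deriv_Sword2.
Qed.

(** The two occurrences do not overlap, and both sides are congruent to f_(m) y: on one side [c] is
    replaced by [y], on the other [u] by [f]. *)
Lemma eqv_disjoint f u (m : 'I_N) c y : S f -> lead eta f u -> wDfree u -> Sword c y ->
  eqv (wcat (prefix_of u m) c) (f *_(m) nword eta c) (lprod eta (prefix_of u m) y).
Proof.
move=> Sf fu uD Xy; apply: (@eqv_trans (f *_(m) y)).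
  apply: eqv_sym; rewrite /eqv -linearB.
  have /Sword_lead1/lead_term1P H := Xy.
  apply: (@gspan_right [::] _ _ m _ _ _ Sf fu uD _ H) => z lt.
  by rewrite wcat0; apply/wlt_wcat.
apply: (@eqv_trans (nword eta u *_(m) y)); last first.
  exact: (nword_gen_top Sword_cons Sword_left).
rewrite /eqv -cprodBl; have /(S_lead1 Sf)/lead_term1P := fu.
apply: (gspan_linear (F := fun x => x *_(m) y)) => [||v _ -> lt].
- exact: cprod_linear_l.
- exact: gspan_subspace.
- apply: (gspan_sub _ (nword_gen_head Sword_cons Sword_left v m Xy)) => z.
  exact: head_le_lt.
Qed.

(** In the names of these lemmas the digits are the kinds of the two normal S-words, the second one
    carrying the prefix [p]. Here the smaller power of D is split off and applied afterwards. What
    remains is a right inclusion, of [g] in [f] or of [f] in [g], or a right intersection if [i]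
    exceeds [j] and [p] is nonempty. *)
Lemma overlap22 p f u i g v j : S f -> lead eta f u -> S g -> lead eta g v ->
  wD u i = wcat p (wD v j) ->
  eqv (wD u i) (iter i cderiv f) (lprod eta p (iter j cderiv g)).
Proof.
move=> Sf fu Sg gv E.
have [ij|/ltnW ji] := leqP i j.
  have Eu : u = wcat p (wD v (j - i)).
    move: E; case: (u) (v) => -[pu bu] iu [[pv bv] iv].
    rewrite /wD /wcat /wprefix /wlast /wind /= => -[-> -> E]; congr (_, _, _); lia.
  have H : eqv u f (lprod eta p (iter (j - i) cderiv g)).
    apply: eqv_composition; last exact: comp_right_inclusion Sf Sg fu gv Eu.
      by have := Sword2 [::] 0 Sf fu; rewrite wcat0 wD0.
    by rewrite Eu; apply: Sword2.
  apply: eqv_trans (eqv_deriv i H) _; rewrite E -{1 3}(subnK ij).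
  exact: iter_deriv_lprod.
have Eu : wD u (i - j) = wcat p v.
  move: E; case: (u) (v) => -[pu bu] iu [[pv bv] iv].
  rewrite /wD /wcat /wprefix /wlast /wind /= => -[-> -> E]; congr (_, _, _); lia.
have H : eqv (wD u (i - j)) (iter (i - j) cderiv f) (lprod eta p g).
  have Xf := Sword2 [::] (i - j) Sf fu; rewrite wcat0 in Xf.
  have Xg : Sword (wD u (i - j)) (lprod eta p g).
    by rewrite Eu -[v]wD0; apply: (@Sword2 p 0).
  have [p0|/prefix_of_nonempty[a [n [aD Ep]]]] := pselect (p = [::]).
    apply: eqv_sym; apply: eqv_composition => //; rewrite p0 /=.
    apply: (comp_right_inclusion (p := [::]) Sg Sf gv fu).
    by rewrite wcat0 Eu p0 wcat0.
  have [ij|ij] := posnP (i - j)%N.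
    apply: eqv_composition => //; rewrite ij /=.
    apply: (comp_right_inclusion (i := 0) Sf Sg fu gv).
    by rewrite wD0 -Eu ij wD0.
  apply: eqv_composition => //; rewrite Ep; apply: comp_right_intersection Sf Sg fu gv aD ij _.
  by rewrite -Ep.
have := eqv_deriv j H; rewrite wD_wD -iterD (subnKC ji) (subnK ji) => H'.
apply: eqv_trans H' _; rewrite E; exact: (@iter_deriv_lprod j p g v 0).
Qed.

Lemma overlap21 p f u i g v (m : 'I_N) c : S f -> lead eta f u -> S g -> lead eta g v ->
  wDfree v -> wD u i = wcat p (wcat (prefix_of v m) c) ->
  eqv (wD u i) (iter i cderiv f) (lprod eta p (g *_(m) nword eta c)).
Proof.
move=> Sf fu Sg gv vD E.
(* [c] without the [i] derivatives: they sit on the last letter, which [u] shares with [c], so [u]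
   itself already contains [v] as an inclusion. *)
pose c0 : word B N := (wprefix c, wlast c, wind u).
have Eu : u = wcat p (wcat (prefix_of v m) c0).
  move: E; rewrite /c0; case: (u) (c) => -[pu bu] iu [[pc bc] ic].
  by rewrite /wD /wcat /wprefix /wlast /wind /= => -[-> -> E].
have Ec : c = wD c0 i.
  move: E; rewrite /c0; case: (u) (c) => -[pu bu] iu [[pc bc] ic].
  by rewrite /wD /wcat /wprefix /wlast /wind /= => -[_ _ ->].
have H : eqv u f (lprod eta p (g *_(m) nword eta c0)).
  apply: eqv_composition; last exact: comp_inclusion Sf Sg fu gv vD Eu.
    by have := Sword2 [::] 0 Sf fu; rewrite wcat0 wD0.
  by rewrite Eu; apply: Sword1.
apply: eqv_trans (eqv_deriv i H) _; rewrite E Ec; exact: iter_deriv_lprod_right.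
Qed.

(** The size condition says that [v] starts inside [u]. This is an intersection, or the inclusion of
    [f] in [g] when [p] is empty. *)
Lemma eqv_overlap p f u g v (m : 'I_N) c : S f -> lead eta f u -> S g -> lead eta g v ->
  wDfree u -> (size p <= size (wprefix u))%N -> wcat (prefix_of u m) c = wcat p v ->
  eqv (wcat p v) (f *_(m) nword eta c) (lprod eta p g).
Proof.
move=> Sf fu Sg gv uD le E.
have Xf : Sword (wcat p v) (f *_(m) nword eta c).
  by have := Sword1 [::] m c Sf fu uD; rewrite wcat0 E.
have Xg : Sword (wcat p v) (lprod eta p g).
  by have := Sword2 p 0 Sg gv; rewrite wD0.
have [p0|/prefix_of_nonempty[a [n [aD Ep]]]] := pselect (p = [::]).
  apply: eqv_sym; apply: eqv_composition => //; rewrite p0 /=.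
  apply: (comp_inclusion (p := [::]) Sg Sf gv fu uD).
  by rewrite wcat0 E p0 wcat0.
apply: eqv_composition => //; rewrite Ep.
apply: (comp_intersection Sf Sg fu gv aD uD (esym E)); first by rewrite Ep.
rewrite wlen_wcat ltn_add2r; exact: le.
Qed.

Lemma overlap12 p f u (m : 'I_N) c g v j : S f -> lead eta f u -> S g -> lead eta g v ->
  wDfree u -> wcat (prefix_of u m) c = wcat p (wD v j) ->
  eqv (wcat (prefix_of u m) c) (f *_(m) nword eta c) (lprod eta p (iter j cderiv g)).
Proof.
move=> Sf fu Sg gv uD E.
have Ep : prefix_of u m ++ wprefix c = p ++ wprefix v by case: E.
have El : wlast c = wlast v by case: E.
have Ei : wind c = (wind v + j)%N by case: E.
have [lt|le] := ltnP (size (wprefix u)) (size p).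
  have [|q Eq Ec] := cat_eq_split Ep; first by rewrite size_prefix_of.
  have Ec' : c = wcat q (wD v j).
    by move: Ec El Ei; case: (c) => -[pc bc] ic; rewrite /wprefix /wlast /wind /= => -> -> ->.
  rewrite Eq lprod_cat; apply: eqv_disjoint => //.
  by rewrite Ec'; apply: Sword2.
pose c0 : word B N := (wprefix c, wlast c, wind v).
have Ec : c = wD c0 j.
  by move: Ei; rewrite /c0; case: (c) => -[pc bc] ic; rewrite /wind /wD /= => ->.
have E0 : wcat (prefix_of u m) c0 = wcat p v.
  by rewrite /wcat /c0 /= Ep El.
have := eqv_deriv j (eqv_overlap Sf fu Sg gv uD le E0).
rewrite E -wcat_wD => H.
have := @iter_deriv_lprod_right j [::] f u m c0 Sf fu uD.
rewrite wcat0 wcat_wD E0 -wcat_wD -Ec => /eqv_sym H'.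
apply: eqv_trans H' _; apply: eqv_trans H _.
exact: (@iter_deriv_lprod j p g v 0).
Qed.

(** The position of [v] relative to [u] decides: after it, inside it, or sticking out on the right.
    In the last two cases a composition is multiplied on the right by what follows, and the products
    are reassociated modulo lower terms. *)
Lemma overlap11 p f u (m : 'I_N) c g v (n : 'I_N) c' :
  S f -> lead eta f u -> S g -> lead eta g v -> wDfree u -> wDfree v ->
  wcat (prefix_of u m) c = wcat p (wcat (prefix_of v n) c') ->
  eqv (wcat (prefix_of u m) c) (f *_(m) nword eta c)
    (lprod eta p (g *_(n) nword eta c')).
Proof.
move=> Sf fu Sg gv uD vD E.
have Ep : prefix_of u m ++ wprefix c = p ++ prefix_of v n ++ wprefix c' by case: E.
have El : wlast c = wlast c' by case: E.
have Ei : wind c = wind c' by case: E.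
(* The word [v] starts after the end of [u]. *)
have [lt|le] := ltnP (size (wprefix u)) (size p).
  have [|q Eq Ec] := cat_eq_split Ep; first by rewrite size_prefix_of.
  have Ec' : c = wcat q (wcat (prefix_of v n) c').
    by move: Ec El Ei; case: (c) => -[pc bc] ic; rewrite /wprefix /wlast /wind /= => -> -> ->.
  rewrite Eq lprod_cat; apply: eqv_disjoint => //.
  by rewrite Ec'; apply: Sword1.
rewrite /prefix_of -!cats1 -!catA in Ep.
have [s Es Es'] := cat_eq_split (esym Ep) le.
have Eu a t i : wprefix u = t -> wlast u = a -> wind u = i -> u = (t, a, i).
  by case: (u) => -[? ?] ?; rewrite /wprefix /wlast /wind /= => -> -> ->.
have Ev a t i : wprefix v = t -> wlast v = a -> wind v = i -> v = (t, a, i).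
  by case: (v) => -[? ?] ?; rewrite /wprefix /wlast /wind /= => -> -> ->.
have [vs|sv] := leqP (size (wprefix v)) (size s).
  (* Now [v] ends inside [u]. An empty remainder means that both end together, a right inclusion;
     otherwise it is an inclusion with the rest [c1] of [u]. *)
  have [[|q t] Et] := cat_eq_split Es' vs.
    rewrite cats0 in Et; case=> Ea Enm Ec.
    have Euv : u = wcat p v.
      by rewrite (Eu _ _ _ Es (esym Ea) uD) /wcat Et vD.
    have Ecc : c' = c.
      by move: Ec El Ei; case: (c) (c') => -[? ?] ? [[? ?] ?]; rewrite /wprefix /wlast /wind /= => -> -> ->.
    have H : eqv u f (lprod eta p g).
      apply: eqv_composition; first by have := Sword2 [::] 0 Sf fu; rewrite wcat0 wD0.
        by have := Sword2 p 0 Sg gv; rewrite wD0 -Euv.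
      by apply: (comp_right_inclusion (i := 0) Sf Sg fu gv); rewrite wD0.
    apply: eqv_trans (eqv_right m c uD H) _; rewrite E Ecc Enm.
    apply: right_lprod_top; by have := Sword2 [::] 0 Sg gv; rewrite wcat0 wD0.
  case=> Eq Ec; pose c1 : word B N := (t, wlast u, 0%N).
  have Euv : u = wcat p (wcat (prefix_of v n) c1).
    by rewrite (Eu _ _ _ Es erefl uD) /wcat Et -Eq /prefix_of /= cat_rcons.
  have Ecc : c' = wcat (prefix_of c1 m) c.
    move: Ec El Ei; rewrite /prefix_of /wcat /= cat_rcons.
    by case: (c) (c') => -[? ?] ? [[? ?] ?]; rewrite /wprefix /wlast /wind /= => -> -> ->.
  have H : eqv u f (lprod eta p (g *_(n) nword eta c1)).
    apply: eqv_composition; first by have := Sword2 [::] 0 Sf fu; rewrite wcat0 wD0.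
      by rewrite Euv; apply: Sword1.
    exact: comp_inclusion Sf Sg fu gv vD Euv.
  apply: eqv_trans (eqv_right m c uD H) _.
  have Xg : Sword (wcat (prefix_of v n) c1) (g *_(n) nword eta c1).
    by have := Sword1 [::] n c1 Sg gv vD; rewrite wcat0.
  have H1 := right_lprod_top p m c Xg.
  rewrite prefix_of_wcat -wcat_wcat -Ecc -E in H1.
  apply: eqv_trans H1 _; rewrite E.
  by apply: eqv_lprod; rewrite Ecc; apply: right_right_top.
(* Now [v] sticks out of [u], and [c1] is the part that does. *)
have [[|q t] Et] := cat_eq_split (esym Es') (ltnW sv).
  by move: sv; rewrite Et cats0 ltnn.
case=> Eq Ec; pose c1 : word B N := (t, wlast v, 0%N).
have E0 : wcat (prefix_of u m) c1 = wcat p v.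
  by rewrite (Ev _ _ _ Et erefl vD) /wcat /prefix_of /= cat_rcons Es -Eq catA.
have Ecc : c = wcat (prefix_of c1 n) c'.
  move: Ec El Ei; rewrite /prefix_of /wcat /= cat_rcons.
  by case: (c) (c') => -[? ?] ? [[? ?] ?]; rewrite /wprefix /wlast /wind /= => -> -> ->.
have pvD : wDfree (wcat p v) by [].
have := eqv_right n c' pvD (eqv_overlap Sf fu Sg gv uD le E0).
rewrite prefix_of_wcat -wcat_wcat -E => H.
apply: eqv_trans; last apply: eqv_trans H _.
  apply: eqv_sym; rewrite Ecc; exact: right_right_top.
rewrite E; apply: right_lprod_top.
by have := Sword2 [::] 0 Sg gv; rewrite wcat0 wD0.
Qed.

(** Once the shorter of the two prefixes is cancelled, one normal S-word has an empty prefix, as the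
    overlap lemmas require; [core] describes such normal S-words. *)
Lemma Sword_eqv w x y : Sword w x -> Sword w y -> eqv w x y.
Proof.
pose core w x := exists f u, [/\ S f, lead eta f u &
  (exists m c, [/\ wDfree u, w = wcat (prefix_of u m) c & x = f *_(m) nword eta c]) \/
  (exists i, w = wD u i /\ x = iter i cderiv f)].
have core_eqv p w1 x1 w2 x2 : core w1 x1 -> core w2 x2 -> w1 = wcat p w2 ->
    eqv w1 x1 (lprod eta p x2).
  move=> [f [u [Sf fu [[m [c [uD -> ->]]]|[i [-> ->]]]]]].
    move=> [g [v [Sg gv [[n [c' [vD -> ->]]]|[j [-> ->]]]]]]; [exact: overlap11|exact: overlap12].
  move=> [g [v [Sg gv [[n [c' [vD -> ->]]]|[j [-> ->]]]]]]; [exact: overlap21|exact: overlap22].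
have coreP w0 x0 : Sword w0 x0 ->
    exists p w1 x1, [/\ core w1 x1, w0 = wcat p w1 & x0 = lprod eta p x1].
  case=> [p f u m c Sf fu uD|p i f u Sf fu].
    exists p, (wcat (prefix_of u m) c), (f *_(m) nword eta c); split=> //.
    by exists f, u; split=> //; left; exists m, c.
  exists p, (wD u i), (iter i cderiv f); split=> //.
  by exists f, u; split=> //; right; exists i.
have ordered p1 p2 w1 w2 x1 x2 : core w1 x1 -> core w2 x2 -> wcat p1 w1 = wcat p2 w2 ->
    (size p1 <= size p2)%N -> eqv (wcat p1 w1) (lprod eta p1 x1) (lprod eta p2 x2).
  move=> X1 X2 E le.
  have [p Ep _] : exists2 p, p2 = p1 ++ p & wprefix w1 = p ++ wprefix w2.
    by apply: cat_eq_split le; case: E.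
  rewrite Ep lprod_cat; apply: eqv_lprod; apply: (core_eqv _ _ _ w2) => //.
  by apply: (@wcat_inj _ _ _ p1); rewrite wcat_wcat -Ep.
move=> /coreP[p1 [w1 [x1 [X1 -> ->]]]] /coreP[p2 [w2 [x2 [X2 E ->]]]].
have [le|/ltnW le] := leqP (size p1) (size p2); first exact: (ordered p1 p2 w1 w2).
by apply: eqv_sym; rewrite E; apply: (ordered p2 p1 w2 w1).
Qed.


(** * Leading words of the ideal, and reduced bases *)

Lemma gspan_bounded P f : V P f -> f = 0 \/ exists2 w, P w & V (wle ^~ w) f.
Proof.
elim=> [|a x y [w Xx Pw] _ IH]; [by left | right].
have Vx w' : wle w w' -> V (wle ^~ w') (a *: x).
  by move=> le; apply: gspanZ; apply: (gspan_gen Xx).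
case: IH => [->|[w' Pw' Vy]].
  by exists w => //; rewrite addr0; apply: Vx; apply: wle_refl.
have [ww'|w'w] : wle w w' \/ wle w' w.
  case: (wlt_total w w') => [->|lt|lt]; [left|left|right]; try exact: wltW.
  exact: wle_refl.
- by exists w' => //; apply: gspanD => //; apply: Vx.
- exists w => //; apply: gspanD; first by apply: Vx; apply: wle_refl.
  by apply: (gspan_sub _ Vy) => z zw'; apply: wle_trans w'w.
Qed.

Lemma gspan_Sword_nword P f : (forall z z', wle z z' -> P z' -> P z) -> V P f -> W P f.
Proof.
move=> Pdown; apply: (gspan_linear (F := id)) => // [|w x /Sword_lead1/lead_termP[_ _ H] Pw].
  exact: gspan_subspace.
by apply: (gspan_sub _ H) => z /Pdown; apply.
Qed.

Hypothesis B_wf : well_founded (fun x y : B => (x < y)%O).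

(** Induction on the bound [w]. All generators with leading word [w] agree modulo lower ones, so [f]
    is a multiple of a single [x0] plus lower generators: either the multiple is nonzero and [w] is
    the leading word, or the bound drops. *)
Lemma gspan_lead w f u : V (wle ^~ w) f -> lead eta f u -> exists x, Sword u x.
Proof.
elim/(well_founded_ind (wlt_wf (N := N) B_wf)): w f => w IH f Vf fu.
have step : V (wlt ^~ w) f -> exists x, Sword u x.
  case/gspan_bounded => [f0|[w' lt /IH]]; last exact.
  by case/leadP: fu; rewrite f0 linear0 eqxx.
have [[x0 Xx0]|noX] := pselect (exists x, Sword w x); last first.
  apply: step; move: Vf; apply: (gspan_linear (F := id)) => // [|v x Xx].
    exact: gspan_subspace.
  case/wleE => [E|lt]; last exact: (gspan_gen Xx).
  by case: noX; exists x; rewrite -E.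
have [a Ha] : exists a, V (wlt ^~ w) (f - a *: x0).
  elim: Vf => [|b x y [v Xx vw] _ [a Ha]].
    by exists 0; rewrite scale0r subrr; apply: gspan0.
  have [a' Ha'] : exists a', V (wlt ^~ w) (x - a' *: x0).
    case/wleE: vw => [E|lt].
      by exists 1; rewrite scale1r; apply: Sword_eqv; rewrite // -E.
    by exists 0; rewrite scale0r subr0; apply: (gspan_gen Xx).
  exists (b * a' + a); rewrite scalerDl opprD addrACA -scalerA -scalerBr.
  by apply: gspanD => //; apply: gspanZ.
have [a0|anz] := eqVneq a 0; first by apply: step; rewrite a0 scale0r subr0 in Ha.
suff fw : lead eta f w by exists x0; rewrite (lead_uniq fu fw).
have {}Ha : W (wlt ^~ w) (f - a *: x0).
  by apply: gspan_Sword_nword Ha => z z'; apply: wle_lt_trans.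
have /lead_termP[_ cx0 Wx0] := Sword_lead1 Xx0.
apply/leadP; rewrite -[f](subrK (a *: x0)); split.
  by rewrite coefD coefZ cx0 mulr1 (gspan_lt_coef Ha) add0r.
apply: gspanD; last exact: gspanZ.
by apply: (gspan_sub _ Ha) => z; apply: wltW.
Qed.

Lemma gspan_ideal : is_ideal (V setT).
Proof.
split=> [|a x y Vx Vy|x|n x y Vx].
- exact: gspan0.
- by apply: gspanD => //; apply: gspanZ.
- by apply: gspan_deriv.
have Wy : W setT y by apply/gspan_nwordP.
split; move: y Wy.
  apply: gspan_linear => [||v _ -> _]; first exact: cprod_linear_r.
    exact: gspan_subspace.
  exact: (gspan_Sword_right _ Vx).
apply: (gspan_linear (F := fun y => y *_(n) x)) => [||v _ -> _].
- exact: cprod_linear_l.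
- exact: gspan_subspace.
move: Vx; apply: gspan_linear => [||w z Xz _]; first exact: cprod_linear_r.
  exact: gspan_subspace.
by apply: (gspan_sub _ (nword_gen_head Sword_cons Sword_left v n Xz)).
Qed.

Lemma ideal_gen_lead f u : ideal_gen S f -> lead eta f u ->
  exists s v, [/\ S s, lead eta s v & wdivides v u].
Proof.
move=> If fu; have Vf : V setT f.
  apply: If; split; first exact: gspan_ideal.
  move=> s Ss; have [v sv] := S_lead Ss.
  by apply: (gspan_gen (Sword2 [::] 0 Ss sv)).
case: (gspan_bounded Vf) => [f0|[w _ /gspan_lead/(_ fu)[x Xx]]].
  by case/leadP: fu; rewrite f0 linear0 eqxx.
exact: Sword_wdivides Xx.
Qed.

End Closed.
End SWords.

(** * Uniqueness of the reduced basis *)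

Section Reduced.
Hypothesis B_wf : well_founded (fun x y : B => (x < y)%O).
Implicit Types S I : set C.

Lemma nword_inj : injective (nword eta : word B N -> C).
Proof.
move=> u v E; have := coef_nword u u; rewrite E coef_nword eqxx.
by case: eqP => // _ /eqP; rewrite eq_sym oner_eq0.
Qed.

Lemma reduced_divides S s v s' u : is_reduced_GSB N eta S -> S s -> coef v s != 0 ->
  S s' -> lead eta s' u -> wdivides u v -> s' = s.
Proof.
move=> [[Smon _] red] Ss sv Ss' s'u uv; apply: contrapT => ne.
have [w /nword_inj Ew noX] := red s v Ss (proj2 (suppP s v) sv).
have S'mon : S `\ s `<=` Defs.monic (N := N) eta by move=> x [/Smon].
have [x Xx] := exists_Sword (S := S `\ s) (conj Ss' ne) s'u uv.
apply: (noX x); first by apply/(normal_SwordP S'mon); exists v.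
by rewrite -Ew; exists 1; apply: (Sword_lead1 S'mon).
Qed.

Lemma GSB_lead S f u : is_GSB (N := N) eta S -> ideal_gen S f -> lead eta f u ->
  exists s v, [/\ S s, lead eta s v & wdivides v u].
Proof. by move=> [Smon Striv]; apply: ideal_gen_lead. Qed.

Lemma reduced_sub S1 S2 : is_reduced_GSB N eta S1 -> is_reduced_GSB N eta S2 ->
  ideal_gen S1 = ideal_gen S2 -> S1 `<=` S2.
Proof.
move=> R1 R2 E s1 S1s1; have [[G1 _] [G2 _]] := (R1, R2).
have I1 : ideal_gen S1 s1 by move=> J [_]; apply.
have [u s1u] := S_lead G1.1 S1s1.
(* Passing to [S2] and back yields an element of [S1] whose leading word divides [u]. Reducedness of
   [S1] forces it to be [s1], so all three leading words coincide. *)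
have [s2 [u2 [S2s2 s2u2 u2u]]] : exists s v, [/\ S2 s, lead eta s v & wdivides v u].
  by apply: GSB_lead s1u => //; rewrite -E.
have I2 : ideal_gen S2 s2 by move=> J [_]; apply.
have [s1' [u1 [S1s1' s1'u1 u1u2]]] : exists s v, [/\ S1 s, lead eta s v & wdivides v u2].
  by apply: GSB_lead s2u2 => //; rewrite E.
have [s1u_nz s1_le] := proj1 (leadP s1 u) s1u.
have Es1 := reduced_divides R1 S1s1 s1u_nz S1s1' s1'u1 (wdivides_trans u1u2 u2u).
have Eu : u1 = u by apply: lead_uniq s1'u1 _; rewrite Es1.
have Eu2 : u2 = u.
  by apply: wle_anti; apply: wdivides_le => //; rewrite -Eu.
rewrite Eu2 in s2u2 => {u2 u2u u1u2 Eu2}.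
have [s2u_nz s2_le] := proj1 (leadP s2 u) s2u2.
have /lead_termP[_ c1 _] := S_lead1 G1.1 S1s1 s1u.
have /lead_termP[_ c2 _] := S_lead1 G2.1 S2s2 s2u2.
suff -> : s1 = s2 by [].
apply: contrapT => ne; have [v dv] : exists v, lead eta (s1 - s2) v.
  by apply: exists_lead => /eqP; rewrite subr_eq0 => /eqP.
have [dv_nz _] := proj1 (leadP _ _) dv.
have vu : wlt v u.
  have : W (wlt ^~ u) (s1 - s2).
    apply: gspan_le_lt; last by rewrite coefB c1 c2 subrr.
    exact: gspanB.
  by move/gspan_nwordP; apply.
(* If [v] occurred in [s], reducedness would make [s] the element whose leading word divides [v];
   but that leading word is [u], which is larger than [v]. *)
have no_small S s : is_reduced_GSB N eta S -> S s -> lead eta s u ->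
    ideal_gen S (s1 - s2) -> coef v s = 0.
  move=> R Ss su Id; apply/eqP; apply: contrapT => /negP nz.
  have [s' [v' [Ss' s'v' v'v]]] := GSB_lead R.1 Id dv.
  have Es := reduced_divides R Ss nz Ss' s'v' v'v.
  have Ev : v' = u by apply: lead_uniq s'v' _; rewrite Es.
  apply: (@wlt_irr _ _ _ u); apply: (wle_lt_trans _ vu).
  by rewrite -Ev; apply: wdivides_le.
have Id1 : ideal_gen S1 (s1 - s2).
  have Is2 : ideal_gen S1 s2 by rewrite E.
  move=> J HJ; have [[_ JP _ _] _] := HJ; rewrite addrC -scaleN1r; apply: JP.
    exact: Is2.
  exact: I1.
move: dv_nz; rewrite coefB (no_small S1) // (no_small S2) ?subrr ?eqxx //.
by rewrite -E.
Qed.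

(** * Existence of the reduced basis *)

Section Existence.
Variable I : set C.
Hypothesis I_ideal : is_ideal I.

Lemma ideal_subspace : subspace I.
Proof. by case: I_ideal. Qed.

Definition ideal_lead u := exists2 f, I f & lead eta f u.

Lemma ideal_lead1 u : ideal_lead u -> exists2 f, I f & lead1 f u.
Proof.
case=> f If /leadP[nz Wf]; exists ((coef u f)^-1 *: f).
  by apply: subspaceZ => //; apply: ideal_subspace.
apply/lead_termP; split; first exact: oner_neq0.
  by rewrite coefZ mulVf.
exact: gspanZ.
Qed.

Lemma ideal_lead_divides u v : ideal_lead u -> wdivides u v -> ideal_lead v.
Proof.
have [_ _ ID IM] := I_ideal.
have Ilprod p x : I x -> I (lprod eta p x).
  by move=> Ix; elim: p => [//|q p IH]; apply: (IM _ _ _ IH).2.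
case/ideal_lead1 => f If fu [[p [i ->]]|[uD [p [m [c ->]]]]].
  exists (lprod eta p (iter i cderiv f)).
    by apply: Ilprod; elim: i => [//|i]; apply: ID.
  by exists 1; apply: lead1_lprod; apply: lead1_iter_deriv.
exists (lprod eta p (f *_(m) nword eta c)).
  by apply: Ilprod; apply: (IM _ _ _ If).1.
by exists 1; apply: lead1_lprod; apply: lead1_right.
Qed.

(** If [w] is a leading word of the ideal, a monic element of the ideal trades [w] for smaller
    words, each of which is reduced by induction. *)
Lemma reduce_word w :
  exists2 r, W (fun z => wle z w /\ ~ ideal_lead z) r & I (nword eta w - r).
Proof.
have subI := ideal_subspace.
elim/(well_founded_ind (wlt_wf (N := N) B_wf)): w => w IH.
have [Iw|nIw] := pselect (ideal_lead w); last first.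
  exists (nword eta w); first by apply: gspan_nword; split=> //; apply: wle_refl.
  by rewrite subrr; apply: subspace0.
have [f If /lead_term1P fw] := ideal_lead1 Iw.
have [r Wr Ir] : exists2 r, W (fun z => wle z w /\ ~ ideal_lead z) r &
    I (f - nword eta w - r).
  elim: fw => [|a x y [z -> zw] _ [r Wr Ir]].
    by exists 0; rewrite ?subrr; [apply: gspan0 | apply: subspace0].
  have [r' Wr' Ir'] := IH z zw; exists (a *: r' + r).
    apply: gspanD => //; apply: gspanZ; apply: (gspan_sub _ Wr') => z' [le nI].
    by split=> //; apply: wle_trans le (wltW zw).
  by rewrite opprD addrACA -scalerBr; apply: subspaceD => //; apply: subspaceZ.
exists (- r); first exact: gspanN.
rewrite (_ : _ - _ = f - (f - nword eta w - r)); first exact: subspaceB.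
by rewrite opprK !opprB addrCA [f + _]addrC subrK addrC.
Qed.

Definition minimal_lead u :=
  ideal_lead u /\ forall v, ideal_lead v -> wdivides v u -> v = u.

Lemma exists_minimal_lead w : ideal_lead w -> exists2 u, minimal_lead u & wdivides u w.
Proof.
elim/(well_founded_ind (wlt_wf (N := N) B_wf)): w => w IH Iw.
have [[v [Iv vw ne]]|nov] := pselect (exists v, [/\ ideal_lead v, wdivides v w & v <> w]).
  have lt : wlt v w by have /wdivides_le/wleE[] := vw.
  have [u mu uv] := IH v lt Iv; exists u => //; exact: wdivides_trans uv vw.
exists w; last exact: wdivides_refl.
by split=> // v Iv vw; apply: contrapT => ne; apply: nov; exists v.
Qed.

Definition reduced_basis : set C := fun f => I f /\ exists u,
  [/\ lead1 f u, minimal_lead u & forall v, coef v f != 0 -> v <> u -> ~ ideal_lead v].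

Lemma exists_reduced u : minimal_lead u -> exists2 f, reduced_basis f & lead1 f u.
Proof.
move=> mu; have subI := ideal_subspace; have [g Ig gu] := ideal_lead1 mu.1.
have [r Wr Ir] := reduce_word u.
have cu : coef u r = 0.
  apply/eqP; apply: contrapT => /negP nz.
  by have [_] := proj1 (gspan_nwordP _ _) Wr u nz; apply; exact: mu.1.
have fu : lead1 (nword eta u - r) u.
  apply/lead_term1P; rewrite addrAC subrr add0r; apply: gspanN.
  apply: gspan_le_lt => //; by apply: (gspan_sub _ Wr) => z [].
exists (nword eta u - r) => //; split=> //; exists u; split=> // v.
rewrite coefB coef_nword; case: (u =P v) => [-> _ []//|_].
rewrite sub0r oppr_eq0 => nz _.
by have [] := proj1 (gspan_nwordP _ _) Wr v nz.
Qed.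

Lemma reduced_basis_monic : reduced_basis `<=` Defs.monic (N := N) eta.
Proof. by move=> f [_ [u [fu _ _]]]; exists u. Qed.

Lemma reduced_basis_sub : reduced_basis `<=` I.
Proof. by move=> f []. Qed.

Lemma ideal_Sword h w : I h -> lead eta h w -> exists x, Sword reduced_basis w x.
Proof.
move=> Ih hw; have [|u mu uw] := @exists_minimal_lead w; first by exists h.
by have [f Rf fu] := exists_reduced mu; apply: exists_Sword Rf _ uw; exists 1.
Qed.

(** Division with strictly decreasing leading words, which stops by well-foundedness. The bound by
    [w] is the one that triviality demands. *)
Lemma ideal_gspan h w : I h -> lead eta h w ->
  gspan (Sword reduced_basis) (wle ^~ w) h.
Proof.
elim/(well_founded_ind (wlt_wf (N := N) B_wf)): w h => w IH h Ih hw.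
have [x Xx] := ideal_Sword Ih hw.
have /lead_termP[_ cx Wx] := Sword_lead1 reduced_basis_monic Xx.
have [_ Wh] := proj1 (leadP h w) hw.
have subI := ideal_subspace.
have Ix : I x by apply: Sword_ideal Xx => //; apply: reduced_basis_sub.
have H : W (wlt ^~ w) (h - coef w h *: x).
  apply: gspan_le_lt; last by rewrite coefB coefZ cx mulr1 subrr.
  by apply: gspanB => //; apply: gspanZ.
rewrite -[h](subrK (coef w h *: x)); apply: gspanD; last first.
  by apply: gspanZ; apply: (gspan_gen Xx); apply: wle_refl.
have [->|nz] := pselect (h - coef w h *: x = 0); first exact: gspan0.
have [w' hw'] := exists_lead nz; have [nz' _] := proj1 (leadP _ _) hw'.
have lt := proj1 (gspan_nwordP _ _) H w' nz'.
have Vh : gspan (Sword reduced_basis) (wle ^~ w') (h - coef w h *: x).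
  by apply: IH => //; apply: subspaceB => //; apply: subspaceZ.
by apply: (gspan_sub _ Vh) => z le; apply: wle_trans le (wltW lt).
Qed.

Lemma composition_ideal S h : S `<=` I -> composition (N := N) eta S h -> I h.
Proof.
have [_ _ ID IM] := I_ideal; have subI := ideal_subspace => SI.
have Ilprod p x : I x -> I (lprod eta p x).
  by move=> Ix; elim: p => [//|q p IH]; apply: (IM _ _ _ IH).2.
have Iiter i x : I x -> I (iter i cderiv x) by move=> Ix; elim: i => [//|i]; apply: ID.
case=> [f g u v p m c Sf Sg _ _ _ _|f g u v p i Sf Sg _ _ _
       |f g u v w a c n m Sf Sg _ _ _ _ _ _ _|f g u v a n i Sf Sg _ _ _ _ _
       |f b n Sf _|f u b n Sf _ _]; have If := SI _ Sf.
- by apply: subspaceB => //; apply: Ilprod; apply: (IM _ _ _ (SI _ Sg)).1.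
- by apply: subspaceB => //; apply: Ilprod; apply: Iiter; apply: SI.
- by apply: subspaceB => //; [apply: (IM _ _ _ If).1 | apply: Ilprod; apply: SI].
- by apply: subspaceB => //; [apply: Iiter | apply: Ilprod; apply: SI].
- exact: (IM _ _ _ If).2.
- exact: (IM _ _ _ If).1.
Qed.

Lemma reduced_basis_GSB : is_GSB (N := N) eta reduced_basis.
Proof.
(* Compositions lie in the ideal, so division makes them trivial without computing any of them. *)
split=> [|h /(composition_ideal reduced_basis_sub) Ih]; first exact: reduced_basis_monic.
have [->|nz] := pselect (h = 0); first by exists [::]; rewrite big_nil.
have [w hw] := exists_lead nz.
have [r [Hr Er]] := span_seq (ideal_gspan Ih hw).
exists r; split=> // q /Hr[w' Xq le].
split; first by apply/(normal_SwordP reduced_basis_monic); exists w'.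
move=> u qu; exists w => //.
have E : u = w'.
  by apply: lead_uniq qu _; exists 1; apply: (Sword_lead1 reduced_basis_monic).
by rewrite E.
Qed.

Lemma reduced_basis_lead_inj s s' u :
  reduced_basis s -> reduced_basis s' -> lead eta s u -> lead eta s' u -> s = s'.
Proof.
move=> Rs Rs' su s'u; apply: contrapT => ne.
have spec f : reduced_basis f -> lead eta f u -> coef u f = 1 /\
    forall v, coef v f != 0 -> v <> u -> ~ ideal_lead v.
  move=> [_ [u' [fu' _ H]]] fu.
  have E : u = u' by apply: lead_uniq fu _; exists 1.
  by rewrite E; split=> //; case/lead_termP: fu'.
have [c1 H1] := spec _ Rs su; have [c2 H2] := spec _ Rs' s'u.
have [v dv] : exists v, lead eta (s - s') v.
  by apply: exists_lead => /eqP; rewrite subr_eq0 => /eqP.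
have Iv : ideal_lead v.
  exists (s - s') => //; apply: subspaceB; first exact: ideal_subspace.
    exact: Rs.1.
  exact: Rs'.1.
have [nz _] := proj1 (leadP _ _) dv.
have vu : v <> u by move=> E; move: nz; rewrite E coefB c1 c2 subrr eqxx.
have z1 : coef v s = 0 by apply/eqP; apply: contrapT => /negP /H1; apply.
have z2 : coef v s' = 0 by apply/eqP; apply: contrapT => /negP /H2; apply.
by move: nz; rewrite coefB z1 z2 subrr eqxx.
Qed.

Lemma reduced_basis_reduced : is_reduced_GSB N eta reduced_basis.
Proof.
split=> [|s v Rs /suppP sv]; first exact: reduced_basis_GSB.
exists v => // y Xy yv.
have mon : reduced_basis `\ s `<=` Defs.monic (N := N) eta.
  by move=> x [/reduced_basis_monic].
have [w Xw] := proj1 (normal_SwordP mon y) Xy.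
have [s' [u' [[Rs' ne] s'u' u'w]]] := Sword_wdivides Xw.
have Ew : w = v by apply: lead_uniq yv; exists 1; apply: (Sword_lead1 mon).
rewrite {}Ew in u'w Xw; have Iu' : ideal_lead u' by exists s' => //; apply: Rs'.1.
have [_ [u [su mu H]]] := Rs.
(* As a multiple of [u'], the word [v] is a leading word of the ideal, and the only such word in [s]
   is [u]. Minimality of [u] then gives u' = u, so [s'] and [s] have the same leading word. *)
have Eu : v = u.
  by apply: contrapT => /(H v sv); apply; apply: ideal_lead_divides u'w.
have Eu' := mu.2 u' Iu'; rewrite -Eu in Eu'; have {}Eu' := Eu' u'w.
apply: ne; apply: (@reduced_basis_lead_inj _ _ u) => //; last by exists 1.
by rewrite -Eu -Eu'.
Qed.

Lemma reduced_basis_gen : ideal_gen reduced_basis = I.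
Proof.
apply/seteqP; split=> [x|x Ix].
  by apply; split=> //; exact: reduced_basis_sub.
have [->|nz] := pselect (x = 0); first by move=> J [[]].
have [w xw] := exists_lead nz; move: (ideal_gspan Ix xw).
have subJ : subspace (ideal_gen reduced_basis).
  split=> [J [[]]//|a y z Jy Jz J HJ].
  by have [[_ JP _ _] _] := HJ; apply: JP; [apply: Jy | apply: Jz].
apply: (gspan_linear (F := id)) => // v y Xy _ J [J_ideal SJ].
exact: Sword_ideal Xy.
Qed.
End Existence.
End Reduced.
End Leading.

Theorem theorem3p22 (k : fieldType) (char_k : [pchar k]%R =i pred0)
  (d : Order.disp_t) (B : orderType d)
  (B_wf : well_founded (fun x y : B => (x < y)%O))
  (N : nat) (C : assocConformalType k) (eta : B -> C)
  (C_free : is_free_assoc_conformal N eta)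
  (I : set C) (I_ideal : is_ideal I) :
  exists! S : set C, is_reduced_GSB N eta S /\ ideal_gen S = I.
Proof.
have [coef [coefP coef_nword coef_expand]] := exists_coef C_free.
have eta_loc := C_free.1.
exists (reduced_basis (eta := eta) coef I).
have red : is_reduced_GSB N eta (reduced_basis (eta := eta) coef I).
  exact: reduced_basis_reduced.
have gen : ideal_gen (reduced_basis (eta := eta) coef I) = I.
  exact: (reduced_basis_gen coefP coef_nword coef_expand eta_loc B_wf).
split=> // S [S_red S_gen]; apply/seteqP; split.
- apply: (reduced_sub coefP coef_nword coef_expand eta_loc B_wf) red S_red _.
  by rewrite gen S_gen.
- apply: (reduced_sub coefP coef_nword coef_expand eta_loc B_wf) S_red red _.
  by rewrite gen S_gen.
Qed.
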